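(* Let $X=(X_t)_{t\ge 0}$ be a real-valued continuous local martingale with $X_0=0$. Then for all $T,R>0$ and all $\sigma^2>0$, $$\mathbb P\left(\int_0^T X_u\,du \geq R\ \text{ and }\ \int_0^T (T-u)^2\,d[X]_u \leq \sigma^2\right) \leq \exp\left(-\frac{R^2}{2\sigma^2}\right).$$ Furthermore, for $0\le t\le T$, $$\int_0^t X_u\,du = \int_0^t (T-u)\,dX_u - (T-t)X_t .$$
   Context: $[X]$ denotes the quadratic variation of $X$; $\int_0^t (T-u)\,dX_u$ is the stochastic integral. *)

(* Defs.v *)
From HB Require Import structures.
From mathcomp Require Import all_boot all_order all_algebra.
From mathcomp Require Import all_classical all_reals all_analysis.
Set Implicit Arguments.
Unset Strict Implicit.
Unset Printing Implicit Defensive.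
Import Order.TTheory GRing.Theory Num.Theory.
Import numFieldNormedType.Exports.
Local Open Scope classical_set_scope.
Local Open Scope ring_scope.

(* A process indexed by [0, +oo[ is a function X : R -> Omega -> R of which
   only the values at times t >= 0 matter. *)

Section StochasticProcesses.
Context (d : measure_display) (Omega : measurableType d) (R : realType).
Context (P : probability Omega R) (F : R -> set (set Omega)).
Implicit Types (s t : R) (X M H I : R -> Omega -> R) (Q : Omega -> cumulative R R).

(* The usual conditions (completeness, right-continuity) are not required. *)
Definition is_filtration : Prop :=
  [/\ forall t, 0 <= t -> sigma_algebra setT (F t),
      forall t, 0 <= t -> F t `<=` measurable &
      forall s t, 0 <= s -> s <= t -> F s `<=` F t].

Definition measurable_wrt (G : set (set Omega)) (f : Omega -> R) : Prop :=
  forall B : set R, measurable B -> G (f @^-1` B).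

Definition adapted X : Prop := forall t, 0 <= t -> measurable_wrt (F t) (X t).

Definition continuous_paths X : Prop :=
  forall w, {within `[0, +oo[, continuous (X ^~ w)}.

(* The last clause is E[M_t | F_s] = M_s a.s., with the definition of the
   conditional expectation unfolded. *)
Definition martingale M : Prop :=
  [/\ adapted M,
      forall t, 0 <= t -> P.-integrable setT (EFin \o M t) &
      forall s t, 0 <= s -> s <= t -> forall A, F s A ->
        (\int[P]_(w in A) (M t w)%:E = \int[P]_(w in A) (M s w)%:E)%E].

Definition stopping_time (tau : Omega -> \bar R) : Prop :=
  (forall w, (0 <= tau w)%E) /\
  forall t, 0 <= t -> F t [set w | (tau w <= t%:E)%E].

Definition stopped (tau : Omega -> \bar R) X : R -> Omega -> R :=
  fun t w => X (fine (mine t%:E (tau w))) w.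

(* X - X_0 is localized, so that X_0 need not be integrable. *)
Definition continuous_local_martingale X : Prop :=
  [/\ adapted X,
      continuous_paths X &
      exists tau : nat -> Omega -> \bar R,
        [/\ forall n, stopping_time (tau n),
            forall w, nondecreasing_seq (tau ^~ w),
            {ae P, forall w, tau n w @[n --> \oo] --> +oo%E} &
            forall n, martingale (fun t w => stopped (tau n) X t w - X 0 w)]].

(* [X] is the continuous nondecreasing adapted process null at 0 such that
   X^2 - [X] is a local martingale (unique up to indistinguishability). Its
   paths are extended by 0 to negative times, so that they are cumulative
   functions and d[X] is their Lebesgue-Stieltjes measure. *)
Definition quadratic_variation X Q : Prop :=
  [/\ forall w t, t <= 0 -> Q w t = 0,
      forall w, continuous (Q w) &
      adapted (fun t w => Q w t) /\
      continuous_local_martingale (fun t w => X t w ^+ 2 - Q w t)].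

(* The simple process \sum_(i < n) xi_i 1_(]t_i, t_(i+1)]) *)
Record simple_process := SimpleProcess {
  sp_size : nat;
  sp_time : nat -> R;
  sp_coef : nat -> Omega -> R }.

Definition simple_predictable (S : simple_process) : Prop :=
  [/\ 0 <= sp_time S 0,
      forall i, (i < sp_size S)%N -> sp_time S i < sp_time S i.+1,
      forall i, (i < sp_size S)%N ->
        measurable_wrt (F (sp_time S i)) (sp_coef S i) &
      exists C : R, forall i w, (i < sp_size S)%N -> `|sp_coef S i w| <= C].

Definition simple_value (S : simple_process) : R -> Omega -> R := fun t w =>
  \sum_(i < sp_size S)
    sp_coef S i w * (sp_time S i < t <= sp_time S i.+1)%R%:R.

Definition simple_integral (S : simple_process) X : R -> Omega -> R :=
  fun t w => \sum_(i < sp_size S) sp_coef S i w *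
    (X (Num.min (sp_time S i.+1) t) w - X (Num.min (sp_time S i) t) w).

Definition cvg_to0_in_probability (Y : nat -> Omega -> \bar R) : Prop :=
  forall e : R, 0 < e ->
    P [set w | (e%:E <= Y n w)%E] @[n --> \oo] --> 0%E.

(* S n --> H in L^2(d[X]) on every [0, t], in probability *)
Definition simple_approximation Q H (S : nat -> simple_process) : Prop :=
  (forall n, simple_predictable (S n)) /\
  forall t, 0 <= t -> cvg_to0_in_probability (fun n w =>
    \int[lebesgue_stieltjes_measure (Q w)]_(u in `[0%R, t])
      ((simple_value (S n) u w - H u w) ^+ 2)%:E)%E.

(* I_t = \int_0^t H_u dX_u, where Q = [X] and H is progressively measurable:
   the continuous adapted process which is the limit in probability of the
   elementary integrals of every sequence of simple processes approximating H
   (cf. Karatzas and Shreve, Brownian Motion and Stochastic Calculus,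
   Definition 3.2.9). The existence of an approximating sequence expresses
   that H is integrable. *)
Definition stochastic_integral X Q H I : Prop :=
  [/\ adapted I,
      continuous_paths I,
      exists S, simple_approximation Q H S &
      forall S, simple_approximation Q H S -> forall t, 0 <= t ->
        cvg_to0_in_probability (fun n w =>
          `|simple_integral (S n) X t w - I t w|%:E)].

End StochasticProcesses.

(* Main.v *)
Require Import Defs.
From HB Require Import structures.
From mathcomp Require Import all_boot all_order all_algebra.
From mathcomp Require Import all_classical all_reals all_analysis.
From mathcomp Require Import ring lra.
From mathcomp Require Import measurable_realfun.
Set Implicit Arguments.
Unset Strict Implicit.
Unset Printing Implicit Defensive.
Import Order.TTheory GRing.Theory Num.Theory.
Import numFieldNormedType.Exports.
Local Open Scope classical_set_scope.
Local Open Scope ring_scope.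

(** The process [M t = int_0^t (T - u) dX_u] equals
    [int_0^t X_u du + (T - t) X_t], so that [M T] is the integral of [X] and
    [A = int_0^T (T - u)^2 d[X]_u] is its bracket at time [T].

    For the tail bound it is enough that [E exp (lam M_T - lam^2 A / 2) <= 1] for
    every positive [lam], for Markov's inequality with [lam = r / sigma^2] then
    gives the result ([chernoff]). This is proved without stochastic calculus and
    with an arbitrary [b > 1 / 2] in place of [1 / 2] ([exponential_bound]). On a
    uniform grid of [`[0, T]], [M_T] and [A] are the limits of
    [sum a_i (X_(i+1) - X_i)] and [sum a_i^2 (QX_(i+1) - QX_i)] with
    [a_i = T - t_i]: the first one by Abel summation, path by path. If all the
    increments are small, the inequality
    [exp (x - b q) <= 1 + x + c (x^2 - q)] ([expR_compensated]), applied to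
    [x = lam a_i (X_(i+1) - X_i)] and [q = lam^2 a_i^2 (QX_(i+1) - QX_i)], shows
    that the exponentials of the partial sums form a supermartingale, since [x]
    and [x^2 - q] have conditional expectation zero ([exp_process_le1]). To make
    the increments small and to have true martingales, all processes are stopped
    at the minimum of two localizing times and of the first time at which some
    grid increment reaches the threshold. By continuity of the paths the stopping
    disappears in the limit of fine grids, and Fatou's lemma gives the bound for
    [M_T] and [A]. The constant [b] tends to [1 / 2] only at the very end.

    The stopped processes are martingales by optional stopping for continuous
    martingales ([martingale_stopped]). If [Y] is the value at a stopping time
    before [t], discretizing the time gives [E (f(Y) (M_t - Y); B) = 0] for every
    bounded continuous [f] such that [x f(x)] is bounded; letting [f] increase to
    [1] needs only the integrability of [Y], which a suitable choice of [f]
    provides.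

    For the second part, the left-point simple processes approximate [T - u] with
    an error at most the mesh, so that their elementary integrals converge in
    probability to the stochastic integral. By Abel summation the same sums
    converge on every path to [int_0^t X_u du + (T - t) X_t - T X_0]. *)

(** * Analysis of real functions *)

Section paths.
Context {R : realType}.
Implicit Types (f g : R -> R) (a b e : R).

(** Freezing a path at its initial value for negative times makes it continuous
    on the whole line; paths are used in this form below, so that compositions
    and Riemann sums need no subspace topology. *)
Lemma continuous_nonneg_ext f :
  {within `[0, +oo[, continuous f} -> continuous (fun u : R => f (Num.max u 0)).
Proof.
move=> cf u.
have D0 v : `[0, +oo[%classic (Num.max v (0 : R)).
  by rewrite /= in_itv/= andbT le_max lexx orbT.
have := (subspace_continuousP _ _).1 cf _ (D0 u).
apply: cvg_comp => A.
have /= cm : (Num.max v 0 @[v --> u] --> Num.max u (0:R)).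
  by apply: continuous_max => //; exact: cvg_cst.
rewrite /within /= nbhs_simpl => /cm; rewrite /= nbhs_simpl /=.
by apply: filterS => v; apply; exact: D0.
Qed.

(** Heine's theorem; the point [y] may leave the segment, which a covering of a
    neighbourhood of each point of the segment gives for free. *)
Lemma uniform_continuity_segment g a b e : continuous g -> 0 < e ->
  exists2 eta, 0 < eta &
    forall x y, a <= x <= b -> `|y - x| < eta -> `|g y - g x| < e.
Proof.
move=> cg e0.
have K : compact `[a, b] by exact: segment_compact.
have /compact_near_coveringP/near_covering_withinP := K.
move=> /(_ R (0^'+) (fun eta x => forall y, `|y - x| < eta -> `|g y - g x| < e)).
case.
- move=> x _; have e2 : 0 < e / 2 by rewrite divr_gt0.
  have /cvgrPdist_lt/(_ _ e2)/nbhs_ballP[d /= d0 H] := cg x.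
  have d2 : 0 < d / 2 by rewrite divr_gt0.
  exists (ball x (d / 2), [set r | r < d / 2]).
    split => /=; first exact: nbhsx_ballx.
    exact: nbhs_right_lt.
  move=> [x' eta] [/= xx' etad] _ y yx'.
  rewrite /ball/= in xx'.
  have h1 : `|g x - g x'| < e / 2.
    by apply: H; rewrite /ball/= (lt_trans xx')// ltr_pdivrMr// ltr_pMr// ltr1n.
  have h2 : `|g x - g y| < e / 2.
    apply: H; rewrite /ball/= -(subrKA x') (le_lt_trans (ler_normD _ _))//.
    rewrite (splitr d) ltrD// distrC (lt_trans yx')//.
  rewrite -(subrKA (g x)) (le_lt_trans (ler_normD _ _))//.
  by rewrite [ltRHS]splitr ltrD// distrC.
- move=> d /= d0 H; exists (d / 2); first by rewrite divr_gt0.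
  move=> x y xab yx; apply: (H (d / 2)) => //.
  + rewrite /ball/= sub0r normrN ger0_norm ?divr_ge0 ?ltW//.
    by rewrite ltr_pdivrMr// ltr_pMr// ltr1n.
  + by rewrite divr_gt0.
Qed.

(** The difference of the two sides vanishes at [0] and is minimal there: its
    derivative is nonpositive on the left because [1 + y <= exp y], and
    nonnegative on the right because [exp y <= 1 / (1 - y)]. *)
Lemma expR_le_quadratic (x k : R) : 0 < k < 1 -> x <= k ->
  expR x <= 1 + x + x ^+ 2 / (2 * (1 - k)).
Proof.
move=> /andP[k0 k1] xk.
set c := (2 * (1 - k))^-1.
have k1' : 0 < 1 - k by rewrite subr_gt0.
have c2 : 1 <= 2 * c.
  by rewrite /c invfM mulVKf ?mulfV// ?pnatr_eq0// invf_ge1// lerBlDr lerDl ltW.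
pose f y := 1 + y + y ^+ 2 * c - expR y.
suff : 0 <= f x by rewrite /f subr_ge0.
have df (y : R) : is_derive y 1 f (1 + 2 * c * y - expR y).
  rewrite /f; apply: is_derive_eq.
  by rewrite /GRing.scale /=; ring.
have cf : continuous f.
  by move=> y; apply/differentiable_continuous/derivable1_diffP; have [] := df y.
have f0 : f 0 = 0 by rewrite /f expR0 expr0n/= mul0r !addr0 subrr.
have [x0|x0] := leP 0 x.
- rewrite -f0; apply: (@ger0_derive1_ndecr _ f 0 k) => //.
  + move=> y; rewrite in_itv/= => /andP[y0 yk].
    rewrite derive1E (@derive_val _ _ _ _ _ _ _ (df y)) subr_ge0.
    have y1 : 0 < 1 - y by rewrite subr_gt0 (lt_trans yk).
    rewrite -[expR y]invrK -expRN.
    apply: (@le_trans _ _ (1 - y)^-1).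
      by rewrite lef_pV2 ?posrE ?expR_gt0//; exact: expR_ge1Dx.
    rewrite -[leLHS]div1r ler_pdivrMr//.
    have : (1 - k) * (2 * c) = 1.
      by rewrite /c invfM mulVKf ?mulfV// ?pnatr_eq0// gt_eqF.
    have -> : (1 + 2 * c * y) * (1 - y) = 1 - y + (2 * c * y) * (1 - y) by ring.
    move=> E; rewrite -subr_ge0.
    have -> : 1 - y + 2 * c * y * (1 - y) - 1 = y * ((1 - y) * (2 * c) - 1) by ring.
    apply: mulr_ge0; first exact: ltW.
    by rewrite subr_ge0 -[leLHS]E ler_wpM2r ?(le_trans ler01)// lerD2l lerN2 ltW.
  + exact: continuous_subspaceT.
- rewrite -f0; apply: (@ler0_derive1_nincr _ f x 0) => //; last first.
  + exact: ltW.
  + exact: continuous_subspaceT.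
  + move=> y; rewrite in_itv/= => /andP[xy y0].
    rewrite derive1E (@derive_val _ _ _ _ _ _ _ (df y)) subr_le0.
    apply: le_trans (expR_ge1Dx y); rewrite lerD2l.
    by rewrite -subr_ge0 -{1}[y]mul1r -mulrBl mulr_le0// ?subr_le0// ltW.
Qed.

(** The inequality behind the exponential supermartingale. When [x] is a small
    increment of a martingale and [q] the increment of its bracket, [x] and
    [x ^+ 2 - q] have conditional expectation zero, hence so has the right-hand
    side minus [1]. With [b = c = 1 / 2] the inequality fails by terms such
    as [x ^+ 3] and [q * x]; the excess [b - 1 / 2] absorbs them once [x] and [q]
    are smaller than a [k] which depends on [b] only. *)
Lemma expR_compensated b : 1 / 2 < b -> exists k c : R,
  [/\ 0 < k, 0 <= c & forall x q : R, `|x| <= k -> 0 <= q -> q <= k ->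
    expR (x - b * q) <= 1 + x + c * (x ^+ 2 - q)].
Proof.
move=> b2.
have b0 : 0 < b by rewrite (lt_trans _ b2).
(* With c = 1 / (2 (1 - k)), the proof needs c <= b (1 - k - c k), which is
   1 + b k <= 2 b (1 - k)^2. Dropping 2 b k^2 >= 0 on the right, it is enough
   that 5 b k <= 2 b - 1. *)
have [k [k0 k1 kb]] : exists k : R, [/\ 0 < k, k < 1 & 1 + b * k <= 2 * b * (1 - k) ^+ 2].
  pose m := (2 * b - 1) / (5 * b).
  exists m; split.
  + by rewrite divr_gt0 ?mulr_gt0//; lra.
  + by rewrite ltr_pdivrMr ?mulr_gt0//; lra.
  + have : m * (5 * b) = 2 * b - 1 by rewrite divfK// gt_eqF ?mulr_gt0.
    by nra.
have k1' : 0 < 1 - k by rewrite subr_gt0.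
exists k, (2 * (1 - k))^-1; split => //; first by rewrite invr_ge0 mulr_ge0// ltW.
move=> x q xk q0 qk.
set c := (2 * (1 - k))^-1.
have ck : 2 * (1 - k) * c = 1 by rewrite mulfV// mulf_neq0// ?gt_eqF.
have c0 : 0 < c by rewrite invr_gt0 mulr_gt0.
have xk1 : x <= k by rewrite (le_trans (ler_norm _)).
have xk2 : - k <= x by rewrite lerNl (le_trans _ xk)// -normrN ler_norm.
have h1 : expR x <= 1 + x + c * x ^+ 2.
  by rewrite mulrC; apply: expR_le_quadratic => //; rewrite k0.
have bq : 0 < 1 + b * q by rewrite ltr_pwDl// mulr_ge0// ltW.
rewrite expRD expRN ler_pdivrMr ?expR_gt0//.
apply: (le_trans h1).
have h0 : c <= b * (1 - k - c * k).
  have : c * (1 + b * k) <= c * (2 * b * (1 - k) ^+ 2) by rewrite ler_wpM2l// ltW.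
  have -> : c * (2 * b * (1 - k) ^+ 2) = (2 * (1 - k) * c) * (b * (1 - k)) by ring.
  by rewrite ck; lra.
have h2 : 0 <= 1 + x + c * (x ^+ 2 - q).
  have : 0 <= 1 - k - c * k by rewrite -(pmulr_rge0 _ b0) (le_trans _ h0)// ltW.
  have : c * q <= c * k by rewrite ler_wpM2l// ltW.
  have : 0 <= c * x ^+ 2 by rewrite mulr_ge0 ?sqr_ge0// ltW.
  by lra.
have h3 : c * q <= c * k by rewrite ler_wpM2l// ltW.
have h4 : 0 <= c * x ^+ 2 by rewrite mulr_ge0 ?sqr_ge0// ltW.
apply: (@le_trans _ _ ((1 + x + c * (x ^+ 2 - q)) * (1 + b * q))); last first.
  by rewrite ler_wpM2l// expR_ge1Dx.
rewrite -subr_ge0.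
have -> : (1 + x + c * (x ^+ 2 - q)) * (1 + b * q) - (1 + x + c * x ^+ 2) =
  q * (b * (1 + x + c * (x ^+ 2 - q)) - c) by ring.
rewrite mulr_ge0// subr_ge0 (le_trans h0)// ler_wpM2l//; first exact: ltW.
rewrite mulrBr. lra.
Qed.

End paths.

(** * Riemann-Stieltjes sums *)

Section lebesgue_stieltjes.
Context {R : realType} (Q : cumulative R R).
Notation mu := (lebesgue_stieltjes_measure Q).
Implicit Types (a b : R) (g : R -> R).

Lemma lebesgue_stieltjes_itvoc a b : a <= b ->
  mu `]a, b]%classic = (Q b - Q a)%:E.
Proof.
move=> ab; rewrite /lebesgue_stieltjes_measure/= /measure_extension.
rewrite measurable_mu_extE/=; last exact: is_ocitv.
exact: wlength_itv_bnd.
Qed.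

(** The atom at [a] is at most [Q a - Q (a - e)] for every positive [e]. *)
Lemma lebesgue_stieltjes_set1 a : {for a, continuous Q} -> mu [set a] = 0%E.
Proof.
move=> cQ; apply/eqP; rewrite eq_le measure_ge0 andbT.
apply/lee_addgt0Pr => e e0; rewrite add0e.
have /cvgrPdist_lt/(_ _ e0)/nbhs_ballP[d /= d0 H] := cQ.
have d2 : 0 < d / 2 by rewrite divr_gt0.
apply: (@le_trans _ _ (mu `]a - d / 2, a]%classic)).
  apply: le_measure; rewrite ?inE; [exact: measurable_set1|exact: measurable_itv|].
  by move=> x /= ->; rewrite in_itv/= lexx andbT ltrBlDr ltrDl.
rewrite lebesgue_stieltjes_itvoc; last by rewrite lerBlDr lerDl ltW.
rewrite lee_fin (le_trans (ler_norm _))// ltW//; apply: H.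
rewrite /ball/= opprB addrC subrK ger0_norm ?ltW//.
by rewrite ltr_pdivrMr// ltr_pMr// ltr1n.
Qed.

Lemma integral_itvcc_itvoc a b (f : R -> R) : {for a, continuous Q} ->
  a <= b -> measurable_fun `[a, b] f -> (forall x, 0 <= f x) ->
  (\int[mu]_(x in `[a, b]) (f x)%:E = \int[mu]_(x in `]a, b]) (f x)%:E)%E.
Proof.
move=> cQ ab mf f0.
rewrite (@ge0_negligible_integral _ _ _ mu `[a, b] [set a])//=.
- by rewrite setDitv1l.
- exact/measurable_EFinP.
- by move=> x _; rewrite lee_fin.
- exact: lebesgue_stieltjes_set1.
Qed.

Lemma integrable_itvoc_bounded a b (f : R -> R) (C : R) :
  measurable_fun `]a, b] f -> (forall x, a < x <= b -> `|f x| <= C) ->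
  mu.-integrable `]a, b] (EFin \o f).
Proof.
move=> mf fC; apply: measurable_bounded_integrable => //.
  have [ab|ba] := leP a b; last by rewrite set_itv_ge ?measure0// bnd_simp -leNgt ltW.
  by apply: (@le_lt_trans _ _ (Q b - Q a)%:E); rewrite ?ltry// -lebesgue_stieltjes_itvoc.
exists C; split; first exact: num_real.
move=> y Cy x /=; rewrite in_itv/= => /fC /le_trans; apply; exact: ltW.
Qed.

Lemma integrable_itvoc_continuous a b g : continuous g ->
  mu.-integrable `]a, b] (EFin \o g).
Proof.
move=> cg.
have mg : measurable_fun `]a, b] g by apply: measurable_funTS; exact: continuous_measurable_fun.
have [ab|ba] := leP a b; last first.
  by rewrite set_itv_ge ?bnd_simp -?leNgt ?ltW//; apply: integrable_set0.
have cng : continuous (fun x => `|g x|) by move=> x; apply: cvg_norm; exact: cg.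
have [c _ H] := @EVT_max _ (fun x => `|g x|) a b ab (continuous_subspaceT cng).
apply: (@integrable_itvoc_bounded _ _ _ `|g c|) => // x /andP[ax xb].
by apply: H; rewrite in_itv/= ltW.
Qed.

Lemma Rintegral_itvoc_sum (f : R -> R) (u : nat -> R) (N : nat) :
  (forall i, (i < N)%N -> u i <= u i.+1) ->
  mu.-integrable `]u 0%N, u N] (EFin \o f) ->
  \int[mu]_(x in `]u 0%N, u N]) f x =
    \sum_(i < N) \int[mu]_(x in `]u i, u i.+1]) f x.
Proof.
elim: N => [|N IH] uu fi; first by rewrite big_ord0 set_itvoc0 Rintegral_set0.
have u0N : u 0%N <= u N.
  elim: N uu {IH fi} => // N IH uu.
  rewrite (le_trans (IH _))//; last by rewrite uu.
  by move=> i iN; apply: uu; rewrite (ltn_trans iN).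
have E : `]u 0%N, u N.+1]%classic = `]u 0%N, u N] `|` `]u N, u N.+1].
  by apply: itv_bndbnd_setU; rewrite bnd_simp// uu.
rewrite big_ord_recr/= -IH; last 2 first.
- by move=> i iN; apply: uu; rewrite (ltn_trans iN).
- by apply: integrableS fi => //; rewrite E; exact: subsetUl.
rewrite [in LHS]E Rintegral_setU//; first by rewrite -E.
apply/disj_setPS => x [/=]; rewrite !in_itv/= => /andP[_ xu] /andP[ux _].
by have := lt_le_trans ux xu; rewrite ltxx.
Qed.

(** Stated for an arbitrary integrable [f] and arbitrary constants [c i], so that
    it also bounds the integral of a discontinuous step error. *)
Lemma stieltjes_riemann_bound (f : R -> R) (u c : nat -> R) (N : nat) (e : R) :
  (forall i, (i < N)%N -> u i <= u i.+1) ->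
  mu.-integrable `]u 0%N, u N] (EFin \o f) ->
  (forall i x, (i < N)%N -> u i < x <= u i.+1 -> `|f x - c i| <= e) ->
  `|\int[mu]_(x in `]u 0%N, u N]) f x -
     \sum_(i < N) c i * (Q (u i.+1) - Q (u i))| <= e * (Q (u N) - Q (u 0%N)).
Proof.
move=> uu fi fc.
have E : \sum_(i < N) e * (Q (u i.+1) - Q (u i)) = e * (Q (u N) - Q (u 0%N)).
  rewrite -mulr_sumr; congr (_ * _).
  by rewrite -(telescope_sumr (fun i => Q (u i)))// big_mkord.
rewrite Rintegral_itvoc_sum// -sumrB -E.
apply: (le_trans (ler_norm_sum _ _ _)); apply: ler_sum => i _.
have ui : `]u i, u i.+1] `<=` `]u 0%N, u N].
  have mono : forall j k, (j <= k)%N -> (k <= N)%N -> u j <= u k.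
    move=> j; elim=> [|k IH]; first by rewrite leqn0 => /eqP ->.
    rewrite leq_eqVlt => /predU1P[->//|]; rewrite ltnS => jk kN.
    by rewrite (le_trans (IH jk (ltnW kN)))// uu.
  move=> x /=; rewrite !in_itv/= => /andP[ux xu]; apply/andP; split.
  - by apply: le_lt_trans ux; apply: mono => //; exact: ltnW.
  - by apply: (le_trans xu); exact: mono.
have fi' : mu.-integrable `]u i, u i.+1] (EFin \o f) by exact: integrableS fi.
have mui := @lebesgue_stieltjes_itvoc _ _ (uu _ (ltn_ord i)).
have cst r : mu.-integrable `]u i, u i.+1] (EFin \o cst r).
  by apply: (@integrable_itvoc_bounded _ _ _ `|r|).
have <- : \int[mu]_(x in `]u i, u i.+1]) c i = c i * (Q (u i.+1) - Q (u i)).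
  by rewrite Rintegral_cst//; congr (_ * _); exact: (congr1 fine mui).
have <- : \int[mu]_(x in `]u i, u i.+1]) e = e * (Q (u i.+1) - Q (u i)).
  by rewrite Rintegral_cst//; congr (_ * _); exact: (congr1 fine mui).
rewrite -RintegralB//; last exact: cst.
have fic : mu.-integrable `]u i, u i.+1] (EFin \o (fun x => f x - c i)).
  by apply: (@integrableB _ _ _ mu _ _ _ _ fi' (cst (c i))); exact: measurable_itv.
apply: (le_trans (le_normr_Rintegral _ fic)) => //.
apply: le_Rintegral => //; [|exact: cst|].
- exact: (integrable_norm fic).
- by move=> x /=; rewrite in_itv/=; exact: fc.
Qed.

(** The partitions need to cover [`[a, b]] only eventually: the partitions of the
    half-line which define simple processes reach a given time from some index
    on. *)
Lemma stieltjes_riemann_cvg g a b (K : R) (N : nat -> nat) (u xi : nat -> nat -> R) :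
  continuous g -> a <= b -> 0 <= K ->
  (\forall n \near \oo, [/\ u n 0%N = a, u n (N n) = b &
    forall i, (i < N n)%N -> u n i <= xi n i <= u n i.+1 /\
                        u n i.+1 - u n i <= K / n.+1%:R]) ->
  \sum_(i < N n) g (xi n i) * (Q (u n i.+1) - Q (u n i)) @[n --> \oo] -->
    \int[mu]_(x in `]a, b]) g x.
Proof.
move=> cg ab K0 H.
have QQ : 0 <= Q b - Q a by rewrite subr_ge0; exact: cumulative_is_nondecreasing.
apply/cvgrPdist_le => e e0.
have QQ1 : 0 < Q b - Q a + 1 by rewrite ltr_wpDl.
have e' : 0 < e / (Q b - Q a + 1) by rewrite divr_gt0.
have [eta eta0 Hg] := @uniform_continuity_segment _ _ a b _ cg e'.
near=> n.
have [u0 uN ui] : [/\ u n 0%N = a, u n (N n) = b &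
    forall i, (i < N n)%N -> u n i <= xi n i <= u n i.+1 /\
                        u n i.+1 - u n i <= K / n.+1%:R] by near: n.
have uu i : (i < N n)%N -> u n i <= u n i.+1.
  by move=> /ui[/andP[+ +] _]; exact: le_trans.
have mono : forall j k, (j <= k)%N -> (k <= N n)%N -> u n j <= u n k.
  move=> j; elim=> [|k IH]; first by rewrite leqn0 => /eqP ->.
  rewrite leq_eqVlt => /predU1P[->//|]; rewrite ltnS => jk kN.
  by rewrite (le_trans (IH jk (ltnW kN)))// uu.
suff osc : forall i x, (i < N n)%N -> u n i < x <= u n i.+1 ->
    `|g x - g (xi n i)| <= e / (Q b - Q a + 1).
  have := @stieltjes_riemann_bound g (u n) (fun i => g (xi n i)) (N n) _
    uu (integrable_itvoc_continuous _ _ cg) osc.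
  rewrite u0 uN => /le_trans; apply.
  by rewrite mulrAC ler_pdivrMr// ler_pM2l// lerDl.
move=> i x iN /andP[ux xu]; apply/ltW; have [/andP[h1 h2] h3] := ui _ iN.
apply: Hg.
  apply/andP; split.
  - by rewrite (le_trans _ h1)// -u0 mono// ltnW.
  - by rewrite (le_trans h2)// -uN mono.
apply: (@le_lt_trans _ _ (K / n.+1%:R)).
  rewrite (le_trans _ h3)// ler_norml opprB; apply/andP; split; lra.
near: n.
have : 0 < eta / (K + 1) by rewrite divr_gt0// ltr_wpDl.
move=> ek.
have := near_infty_natSinv_lt (PosNum ek); apply: filterS => n /= hn.
have K1 : 0 < K + 1 by rewrite ltr_wpDl.
apply: (@le_lt_trans _ _ ((K + 1) / n.+1%:R)).
  by rewrite ler_wpM2r// lerDl.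
by rewrite mulrC -ltr_pdivlMr.
Unshelve. all: by end_near. Qed.

Lemma grid_stieltjes_cvg g b : continuous g -> 0 <= b ->
  \sum_(i < n.+1) g (b * i%:R / n.+1%:R) *
    (Q (b * i.+1%:R / n.+1%:R) - Q (b * i%:R / n.+1%:R)) @[n --> \oo] -->
    \int[mu]_(x in `]0, b]) g x.
Proof.
move=> cg b0; pose u n i : R := b * i%:R / n.+1%:R.
apply: (@stieltjes_riemann_cvg g 0 b b (fun n => n.+1) u u) => //.
apply: nearW => n; split; rewrite /u.
- by rewrite mulr0 mul0r.
- by rewrite -mulrA mulfV ?mulr1// pnatr_eq0.
- move=> i _; split; last by rewrite -mulrBl -mulrBr -natrB// subSnn mulr1.
  by rewrite lexx ler_pM2r ?invr_gt0// ler_wpM2l// ler_nat.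
Qed.

End lebesgue_stieltjes.

(** * Measurability with respect to a sub-sigma-algebra *)

Section measurable_wrt.
Context (d : measure_display) (Omega : measurableType d) (R : realType).
Context (G : set (set Omega)) (hG : sigma_algebra setT G).
Implicit Types (f g : Omega -> R).

(** A sigma-algebra is the one that it generates, so that this kind of
    measurability is the usual one on the space whose measurable sets are [G],
    and its closure properties follow. *)
Lemma measurable_wrtE f :
  measurable_wrt G f <-> measurable_fun [set: g_sigma_algebraType G] f.
Proof.
have E : @measurable _ (g_sigma_algebraType G) = G.
  exact: measurable_g_measurableTypeE.
split=> [mf _ B mB|mf B mB]; first by rewrite setTI E; exact: mf.
by have := mf measurableT B mB; rewrite setTI E.
Qed.

Lemma measurable_wrt_cst (c : R) : measurable_wrt G (fun _ : Omega => c).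
Proof. by apply/measurable_wrtE; exact: measurable_cst. Qed.

Lemma measurable_wrtD f g : measurable_wrt G f -> measurable_wrt G g ->
  measurable_wrt G (fun w => f w + g w).
Proof.
by move=> /measurable_wrtE mf /measurable_wrtE mg; apply/measurable_wrtE; exact: measurable_funD.
Qed.

Lemma measurable_wrtM f g : measurable_wrt G f -> measurable_wrt G g ->
  measurable_wrt G (fun w => f w * g w).
Proof.
by move=> /measurable_wrtE mf /measurable_wrtE mg; apply/measurable_wrtE; exact: measurable_funM.
Qed.

Lemma measurable_wrtB f g : measurable_wrt G f -> measurable_wrt G g ->
  measurable_wrt G (fun w => f w - g w).
Proof.
by move=> /measurable_wrtE mf /measurable_wrtE mg; apply/measurable_wrtE; exact: measurable_funB.
Qed.

Lemma measurable_wrt_comp f (h : R -> R) : measurable_fun setT h ->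
  measurable_wrt G f -> measurable_wrt G (fun w => h (f w)).
Proof.
by move=> mh /measurable_wrtE mf; apply/measurable_wrtE; exact: measurableT_comp.
Qed.

Lemma measurable_wrt_max f g : measurable_wrt G f -> measurable_wrt G g ->
  measurable_wrt G (fun w => Num.max (f w) (g w)).
Proof.
by move=> /measurable_wrtE mf /measurable_wrtE mg; apply/measurable_wrtE; exact: measurable_maxr.
Qed.

Lemma measurable_wrt_sum N (f : nat -> Omega -> R) :
  (forall i, (i < N)%N -> measurable_wrt G (f i)) ->
  measurable_wrt G (fun w => \sum_(i < N) f i w).
Proof.
elim: N => [|N IH] mf.
  under [X in measurable_wrt _ X]eq_fun do rewrite big_ord0.
  exact: measurable_wrt_cst.
under [X in measurable_wrt _ X]eq_fun do rewrite big_ord_recr/=.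
apply: measurable_wrtD; last exact: mf.
by apply: IH => i iN; apply: mf; rewrite (ltn_trans iN).
Qed.

Lemma measurable_wrt_cvg (h : nat -> Omega -> R) f :
  (forall n, measurable_wrt G (h n)) ->
  (forall w, h n w @[n --> \oo] --> f w) -> measurable_wrt G f.
Proof.
move=> mh hf; apply/measurable_wrtE.
apply: (@measurable_fun_cvg _ (g_sigma_algebraType G) R setT h) => // m.
exact/measurable_wrtE.
Qed.

Lemma measurable_wrt_indic (A : set Omega) : G A ->
  measurable_wrt G (\1_A : Omega -> R).
Proof.
move=> GA; apply/measurable_wrtE.
apply: (@measurable_indic _ (g_sigma_algebraType G)).
by rewrite measurable_g_measurableTypeE.
Qed.

Lemma measurable_wrtS (G' : set (set Omega)) f : G `<=` G' ->
  measurable_wrt G f -> measurable_wrt G' f.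
Proof. by move=> GG' mf B mB; apply: GG'; exact: mf. Qed.

Lemma measurable_wrt_measurable f : G `<=` measurable ->
  measurable_wrt G f -> measurable_fun setT f.
Proof. by move=> Gm mf _ B mB; rewrite setTI; apply: Gm; exact: mf. Qed.

End measurable_wrt.

(** * Expectations *)

Section expectation.
Context (d : measure_display) (Omega : measurableType d) (R : realType).
Context (P : probability Omega R).
Implicit Types (f g Z D : Omega -> R).

Definition integ f := P.-integrable setT (EFin \o f).
Definition EP f : R := (\int[P]_w f w)%R.

Lemma integ_measurable f : integ f -> measurable_fun setT f.
Proof. by move=> /measurable_int/measurable_EFinP. Qed.

Lemma integ_bounded f (C : R) : measurable_fun setT f ->
  (forall w, `|f w| <= C) -> integ f.
Proof.
move=> mf fC; apply: measurable_bounded_integrable => //.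
  by apply: (@le_lt_trans _ _ 1%E); [exact: probability_le1|exact: ltry].
exists C; split; first exact: num_real.
by move=> y Cy x _; rewrite /= (le_trans (fC _))// ltW.
Qed.

Lemma integ_cst (c : R) : integ (fun _ => c).
Proof. by apply: (@integ_bounded _ `|c|). Qed.

Lemma integD f g : integ f -> integ g -> integ (fun w => f w + g w).
Proof. by move=> fi gi; apply: (integrableD _ fi gi). Qed.

Lemma integB f g : integ f -> integ g -> integ (fun w => f w - g w).
Proof. by move=> fi gi; apply: (integrableB _ fi gi). Qed.

Lemma integ_norm f : integ f -> integ (fun w => `|f w|).
Proof. exact: integrable_norm. Qed.

Lemma integMb Z D (C : R) : measurable_fun setT Z -> (forall w, `|Z w| <= C) ->
  integ D -> integ (fun w => Z w * D w).
Proof.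
move=> mZ ZC iD; apply: (integrableMr _ mZ _ iD) => //.
exists C; split; first exact: num_real.
by move=> y Cy x _; rewrite /= (le_trans (ZC _))// ltW.
Qed.

Lemma integ_sum N (f : nat -> Omega -> R) :
  (forall i, (i < N)%N -> integ (f i)) -> integ (fun w => \sum_(i < N) f i w).
Proof.
elim: N => [|N IH] fi.
  by under [X in integ X]eq_fun do rewrite big_ord0; exact: integ_cst.
under [X in integ X]eq_fun do rewrite big_ord_recr/=.
apply: integD; last exact: fi.
by apply: IH => i iN; apply: fi; rewrite (ltn_trans iN).
Qed.

Lemma le_integ f g : measurable_fun setT f -> (forall w, `|f w| <= g w) ->
  integ g -> integ f.
Proof.
move=> mf fg; apply: le_integrable => //; first exact/measurable_EFinP.
by move=> w _ /=; rewrite lee_fin (le_trans (fg w))// ler_norm.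
Qed.

Lemma EPD f g : integ f -> integ g -> EP (fun w => f w + g w) = EP f + EP g.
Proof. by move=> fi gi; rewrite /EP RintegralD. Qed.

Lemma EPB f g : integ f -> integ g -> EP (fun w => f w - g w) = EP f - EP g.
Proof. by move=> fi gi; rewrite /EP RintegralB. Qed.

Lemma EPZl (c : R) f : integ f -> EP (fun w => c * f w) = c * EP f.
Proof. by move=> fi; rewrite /EP RintegralZl. Qed.

Lemma EP_cst (c : R) : EP (fun _ => c) = c.
Proof.
rewrite /EP Rintegral_cst//; rewrite (_ : fine _ = 1) ?mulr1//.
exact: (congr1 fine (probability_setT P)).
Qed.

Lemma EP_sum N (f : nat -> Omega -> R) : (forall i, (i < N)%N -> integ (f i)) ->
  EP (fun w => \sum_(i < N) f i w) = \sum_(i < N) EP (f i).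
Proof.
elim: N => [|N IH] fi.
  by rewrite big_ord0; under [X in EP X]eq_fun do rewrite big_ord0; exact: EP_cst.
rewrite big_ord_recr/= -IH; last by move=> i iN; apply: fi; rewrite (ltn_trans iN).
rewrite -EPD//; first by congr EP; apply/funext => w; rewrite big_ord_recr.
- by apply: integ_sum => i iN; apply: fi; rewrite (ltn_trans iN).
- exact: fi.
Qed.

Lemma le_EP f g : integ f -> integ g -> (forall w, f w <= g w) -> EP f <= EP g.
Proof. by move=> fi gi fg; apply: le_Rintegral => // w _; exact: fg. Qed.

Lemma EP_indic f (A : set Omega) :
  EP (fun w => \1_A w * f w) = (\int[P]_(w in A) f w)%R.
Proof.
rewrite [RHS]Rintegral_mkcond patch_indic; congr (Rintegral P _ _).
by apply/funext => w; rewrite mulrC.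
Qed.

Lemma EP_cvg (h : nat -> Omega -> R) f g :
  (forall n, measurable_fun setT (h n)) ->
  (forall w, h n w @[n --> \oo] --> f w) -> integ g ->
  (forall n w, `|h n w| <= g w) ->
  integ f /\ EP (h n) @[n --> \oo] --> EP f.
Proof.
move=> mh hf gi hg.
have mf : measurable_fun setT f by apply: (measurable_fun_cvg mh) => w _; exact: hf.
have fi : integ f.
  apply: (le_integ mf _ gi) => w.
  have hn : `|h n w| @[n --> \oo] --> `|f w| by apply: cvg_norm; exact: hf.
  rewrite -(cvg_lim _ hn)//; apply: limr_le; first by apply/cvg_ex; eexists; exact: hn.
  by apply: nearW => n; exact: hg.
split=> //.
have := @dominated_cvg _ _ _ P setT measurableT (fun n => EFin \o h n) (EFin \o f) (EFin \o g).
move=> /(_ (fun n => (measurable_EFinP _ _).2 (mh n))).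
have h1 w : setT w -> (EFin \o h x) w @[x --> \oo] --> (EFin \o f) w.
  by move=> _; apply: cvg_EFin; [exact: nearW|exact: hf].
have h2 w : setT w -> (EFin \o g) w \is a fin_num by [].
have h3 n w : setT w -> (`|(EFin \o h n) w| <= (EFin \o g) w)%E.
  by move=> _; rewrite lee_fin.
move=> /(_ h1 h2 gi h3).
rewrite -(fineK (integrable_fin_num measurableT fi)) => /fine_cvg.
exact.
Qed.

(** Fatou's lemma for an almost surely convergent sequence; the integral of the
    limit is extended-real because its finiteness is part of the conclusion. *)
Lemma fatou_le (h : nat -> Omega -> R) f (C : R) :
  (forall n, measurable_fun setT (h n)) -> measurable_fun setT f ->
  {ae P, forall w, h n w @[n --> \oo] --> f w} ->
  (forall n w, 0 <= h n w) -> (forall n, integ (h n)) ->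
  (forall n, EP (h n) <= C) ->
  (\int[P]_w (f w)%:E <= C%:E)%E.
Proof.
move=> mh mf hf h0 hi hC.
have mh' n : measurable_fun setT (EFin \o h n) by exact/measurable_EFinP.
have h0' n w : setT w -> (0 <= (EFin \o h n) w)%E by rewrite lee_fin.
have mlim : measurable_fun setT (fun w => limn_einf (fun n => (h n w)%:E)).
  apply: (emeasurable_fun_cvg _ _ (measurable_fun_einfs mh')) => w _.
  by rewrite limn_einf_lim; exact: is_cvg_einfs.
rewrite (@ae_eq_integral _ _ _ P setT (fun w => limn_einf (fun n => (h n w)%:E)))//; last 2 first.
- exact/measurable_EFinP.
- apply: filterS hf => w hw _.
  have : (EFin \o h^~ w) n @[n --> \oo] --> (f w)%:E.
    by apply: cvg_EFin => //; exact: nearW.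
  by move=> /cvg_limn_einf_sup[<-].
apply: le_trans (fatou P measurableT mh' h0') _.
rewrite limn_einf_lim; apply: lime_le; first exact: is_cvg_einfs.
apply: nearW => n; apply: (@le_trans _ _ (\int[P]_w (h n w)%:E)%E).
  by apply: ereal_inf_lbound; exists n => //=.
rewrite -(fineK (integrable_fin_num measurableT (hi n))) lee_fin.
exact: hC.
Qed.

End expectation.

Section weighted.
Context (d : measure_display) (Omega : measurableType d) (R : realType).
Context (P : probability Omega R).
Context (G : set (set Omega)) (hG : sigma_algebra setT G) (Gm : G `<=` measurable).
Local Notation E := (EP P).

(** The weight [Z], shifted to be nonnegative, is the uniform limit of
    [floor ((m + 1) Z) / (m + 1)]. This function has finitely many values and its
    level sets are in [G], so its product with [D] has expectation zero by
    linearity. *)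
Lemma EP_orthogonal (D Z : Omega -> R) (C : R) : integ P D ->
  (forall A, G A -> E (fun w => \1_A w * D w) = 0) ->
  measurable_wrt G Z -> (forall w, `|Z w| <= C) ->
  E (fun w => Z w * D w) = 0.
Proof.
move=> iD D0.
have pos : forall Z C, measurable_wrt G Z -> (forall w, 0 <= Z w <= C) ->
    E (fun w => Z w * D w) = 0.
  move=> {}Z {}C mZ ZC.
  pose Zm (m : nat) w : R := (Num.truncn (Z w * m.+1%:R))%:R / m.+1%:R.
  have Zm_le m w : Z w - m.+1%:R^-1 <= Zm m w <= Z w.
    have /andP[h1 h2] : (Num.truncn (Z w * m.+1%:R))%:R <= Z w * m.+1%:R <
        (Num.truncn (Z w * m.+1%:R)).+1%:R.
      by apply: truncn_itv; rewrite mulr_ge0//; case/andP: (ZC w).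
    apply/andP; split; last by rewrite ler_pdivrMr.
    by rewrite lerBlDr /Zm -[X in _ + X]div1r -mulrDl natr1 ler_pdivlMr// ltW.
  pose A m j := [set w | Num.truncn (Z w * m.+1%:R) = j].
  have GA m j : G (A m j).
    have -> : A m j = (fun w => Z w * m.+1%:R) @^-1` `[j%:R, j.+1%:R[.
      apply/seteqP; split=> w /=; rewrite in_itv/=.
        move=> <-; apply: truncn_itv; rewrite mulr_ge0//.
        by case/andP: (ZC w).
      exact: truncn_def.
    apply: (measurable_wrtM hG mZ (measurable_wrt_cst hG _)).
    exact: measurable_itv.
  pose J m := (Num.truncn (C * m.+1%:R)).+1.
  have ZmE m w : Zm m w = \sum_(j < J m) (j%:R / m.+1%:R) * \1_(A m j) w.
    have jJ : (Num.truncn (Z w * m.+1%:R) < J m)%N.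
      rewrite ltnS; apply: le_truncn.
      by rewrite ler_wpM2r//; case/andP: (ZC w).
    rewrite (bigD1 (Ordinal jJ))//= big1 ?addr0.
      by rewrite indicE mem_set// mulr1.
    move=> i /negP iJ; rewrite indicE memNset ?mulr0// /A/= => Ei.
    by apply: iJ; apply/eqP/val_inj.
  have mA m j : measurable (A m j) by exact/Gm/GA.
  have iA m j : integ P (fun w => \1_(A m j) w * D w).
    apply: (@integMb _ _ _ _ _ _ 1) => // w.
    by rewrite indicE; case: (_ \in _); rewrite ?normr1 ?normr0.
  have mZm m : measurable_fun setT (Zm m).
    rewrite (_ : Zm m = fun w => \sum_(j < J m) (j%:R / m.+1%:R) * \1_(A m j) w); last first.
      by apply/funext => w; exact: ZmE.
    apply: measurable_sum => j; apply: measurable_funM => //.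
  have Zm0 m : E (fun w => Zm m w * D w) = 0.
    rewrite (_ : (fun w => _) = (fun w =>
      \sum_(j < J m) ((j%:R / m.+1%:R) * (\1_(A m j) w * D w)))); last first.
      apply/funext => w; rewrite ZmE mulr_suml; apply: eq_bigr => j _.
      by rewrite mulrA.
    rewrite (@EP_sum _ _ _ _ _ (fun j w => j%:R / m.+1%:R * (\1_(A m j) w * D w))).
      rewrite big1// => j _.
      by rewrite EPZl// D0 ?mulr0.
    move=> j _; apply: (@integMb _ _ _ _ _ _ `|j%:R / m.+1%:R|) => //.
  have C0 (w : Omega) : 0 <= C by have /andP[h1 h2] := ZC w; exact: le_trans h2.
  have [| | | |_] := @EP_cvg _ _ _ P (fun m w => Zm m w * D w) (fun w => Z w * D w)
    (fun w => C * `|D w|).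
  - by move=> n; apply: measurable_funM => //; exact: (integ_measurable iD).
  - move=> w; apply: cvgMr_tmp.
    apply: (@squeeze_cvgr _ _ _ _ (fun n => Z w - n.+1%:R^-1) (fun=> Z w)).
    + by apply: nearW => n; exact: Zm_le.
    + rewrite -[X in _ --> X]subr0; apply: cvgB; [exact: cvg_cst|].
      exact: cvg_harmonic.
    + exact: cvg_cst.
  - by apply: (@integMb _ _ _ _ _ _ `|C|) => //; exact: integ_norm.
  - move=> n w; rewrite normrM ler_wpM2r//.
    have /andP[_ h] := Zm_le n w; have /andP[_ h'] := ZC w.
    by rewrite ger0_norm ?(le_trans h)// divr_ge0.
  - under eq_fun do rewrite Zm0.
    by move=> /(cvg_unique _ (cvg_cst _)) => ->.
move=> mZ ZC.
have mZ' := measurable_wrt_measurable Gm mZ.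
have C0 (w : Omega) : 0 <= C by rewrite (le_trans _ (ZC w)).
have h1 : E (fun w => (Z w + C) * D w) = 0.
  apply: (pos _ (C + C)).
    by apply: measurable_wrtD => //; exact: measurable_wrt_cst.
  move=> w; have := ZC w; rewrite ler_norml => /andP[ZC1 ZC2].
  by rewrite -lerBlDr sub0r ZC1 lerD2r.
have h2 : E (fun w => C * D w) = 0.
  have -> : (fun w => C * D w) = (fun w => C * (\1_setT w * D w)).
    by apply/funext => w; rewrite indicE mem_set// mul1r.
  rewrite EPZl ?D0 ?mulr0//; last first.
    by under [X in integ _ X]eq_fun do rewrite indicE mem_set// mul1r.
  by have [h0 hC _] := hG; rewrite -(setD0 setT); exact: hC.
rewrite (_ : (fun w => Z w * D w) = (fun w => (Z w + C) * D w - C * D w)); last first.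
  by apply/funext => w; ring.
rewrite EPB ?h1 ?h2 ?subr0//.
- apply: (@integMb _ _ _ _ _ _ (C + C)) => //.
    by apply: measurable_funD.
  by move=> w; rewrite (le_trans (ler_normD _ _))// lerD// ger0_norm// (C0 w).
- apply: (@integMb _ _ _ _ _ _ `|C|) => //.
Qed.

End weighted.

(** * Optional stopping *)

Section cap.
Context {R : realType}.
Implicit Types (s t u : R) (x y : \bar R).

(** The real number at which [stopped] evaluates a path. *)
Definition cap t x : R := fine (mine t%:E x).

Lemma cap_fin t (r : R) : cap t r%:E = Num.min t r.
Proof. by rewrite /cap -EFin_min. Qed.

Lemma cap_pinfty t : cap t +oo%E = t.
Proof. by rewrite /cap miney. Qed.

Lemma cap_ge0 t x : 0 <= t -> (0 <= x)%E -> 0 <= cap t x.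
Proof.
case: x => [r||] t0 //; last by rewrite cap_pinfty.
by rewrite cap_fin lee_fin le_min t0.
Qed.

Lemma cap_le t x : (0 <= x)%E -> cap t x <= t.
Proof.
case: x => [r||] //; last by rewrite cap_pinfty.
by rewrite cap_fin ge_min lexx.
Qed.

Lemma cap_le_fin u t x : (0 <= x)%E -> u < t -> (x <= u%:E)%E = (cap t x <= u).
Proof.
case: x => [r||] // _ ut; last by rewrite cap_pinfty leye_eq leNgt ut.
by rewrite cap_fin lee_fin ge_min [t <= u]leNgt ut.
Qed.

Lemma cap_min s t x : s <= t -> (0 <= x)%E -> cap s x = Num.min s (cap t x).
Proof.
case: x => [r||] // st _; rewrite ?cap_fin ?cap_pinfty; last by rewrite min_l.
by rewrite minA (min_l st).
Qed.

Lemma cap_id t x : (t%:E <= x)%E -> cap t x = t.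
Proof. by move=> tx; rewrite /cap min_l. Qed.

Lemma cap_cap t x y : (0 <= x)%E -> (x <= y)%E -> cap (cap t x) y = cap t x.
Proof.
move=> x0 xy; apply: cap_id; apply: le_trans xy.
case: x x0 => [r||] //; rewrite ?cap_fin ?leey// => _.
by rewrite lee_fin ge_min lexx orbT.
Qed.

Lemma cap_fin_le t x : (0 <= x)%E -> ((cap t x)%:E <= x)%E.
Proof.
case: x => [r||] //; rewrite ?cap_fin ?leey// => _.
by rewrite lee_fin ge_min lexx orbT.
Qed.

Lemma continuous_cap x : (0 <= x)%E -> continuous (fun t => cap t x).
Proof.
case: x => [r||] // _ t.
- under eq_fun do rewrite cap_fin.
  by apply: continuous_min => //; exact: cvg_cst.
- under eq_fun do rewrite cap_pinfty.
  exact: cvg_id.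
Qed.

End cap.

Lemma cvg_continuous_comp (R : realType) (f : R -> R) (u : nat -> R) (l : R) :
  continuous f -> u n @[n --> \oo] --> l -> f (u n) @[n --> \oo] --> f l.
Proof. by move=> cf ul; apply: continuous_cvg => //; exact: cf. Qed.

Section optional_stopping.
Context (d : measure_display) (Omega : measurableType d) (R : realType).
Context (P : probability Omega R) (F : R -> set (set Omega)).
Hypothesis hF : is_filtration F.
Local Notation E := (EP P).
Implicit Types (M X : R -> Omega -> R) (s t : R).

Lemma filtration_sigma t : 0 <= t -> sigma_algebra setT (F t).
Proof. by case: hF => h _ _; exact: h. Qed.

Lemma filtration_measurable t : 0 <= t -> F t `<=` measurable.
Proof. by case: hF => _ h _; exact: h. Qed.

Lemma filtration_mono s t : 0 <= s -> s <= t -> F s `<=` F t.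
Proof. by case: hF => _ _ h; exact: h. Qed.

Lemma adapted_measurable X t : adapted F X -> 0 <= t -> measurable_fun setT (X t).
Proof.
move=> aX t0; apply: measurable_wrt_measurable (aX _ t0).
exact: filtration_measurable.
Qed.

Lemma adapted_wrt X s t : adapted F X -> 0 <= s -> s <= t ->
  measurable_wrt (F t) (X s).
Proof.
by move=> aX s0 st; apply: measurable_wrtS (aX _ s0); exact: filtration_mono.
Qed.

Lemma martingale_integ M t : martingale P F M -> 0 <= t -> integ P (M t).
Proof. by case=> _ h _; exact: h. Qed.

(** The martingale property in the form in which it is used: bounded weights
    known at time [s] instead of events. *)
Lemma martingale_orthogonal M s t (Z : Omega -> R) (C : R) : martingale P F M ->
  0 <= s -> s <= t -> measurable_wrt (F s) Z -> (forall w, `|Z w| <= C) ->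
  E (fun w => Z w * (M t w - M s w)) = 0.
Proof.
move=> hM s0 st mZ ZC; have [_ _ hE] := hM.
have t0 := le_trans s0 st.
have iD : integ P (fun w => M t w - M s w).
  by apply: integB; exact: martingale_integ.
apply: (EP_orthogonal (filtration_sigma s0) (filtration_measurable s0) iD _ mZ ZC).
move=> A FA; have mA := filtration_measurable s0 FA.
rewrite EP_indic RintegralB//.
- by rewrite /Rintegral (hE _ _ s0 st _ FA) subrr.
- by apply: integrableS (martingale_integ hM t0).
- by apply: integrableS (martingale_integ hM s0).
Qed.

Lemma martingale_of_orthogonal M : adapted F M ->
  (forall t, 0 <= t -> integ P (M t)) ->
  (forall s t A, 0 <= s -> s <= t -> F s A ->
    E (fun w => \1_A w * (M t w - M s w)) = 0) ->
  martingale P F M.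
Proof.
move=> aM iM h; split=> //.
move=> s t s0 st A FA.
have t0 := le_trans s0 st.
have mA := filtration_measurable s0 FA.
have := h _ _ _ s0 st FA; rewrite EP_indic.
have iA u : 0 <= u -> P.-integrable A (EFin \o M u).
  by move=> u0; apply: integrableS (iM _ u0).
rewrite RintegralB; [|exact: mA|exact: iA|exact: iA].
rewrite /Rintegral => /eqP; rewrite subr_eq0 => /eqP.
have fin u : 0 <= u -> (\int[P]_(w in A) (M u w)%:E \is a fin_num)%E.
  by move=> u0; apply: integrable_fin_num => //; exact: iA.
by move=> e; rewrite -[LHS]fineK ?fin// e fineK// fin.
Qed.

Section stop.
Context (M : R -> Omega -> R) (rho : Omega -> \bar R).
Hypotheses (hM : martingale P F M) (cM : continuous_paths M).
Hypothesis hrho : stopping_time F rho.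

Let rho0 w : (0 <= rho w)%E. Proof. by case: hrho. Qed.

Let aM : adapted F M. Proof. by case: hM. Qed.

Section interval.
Context (s t : R) (s0 : 0 <= s) (st : s < t).

(** The stopping time is approximated from above by the first grid point that
    is not smaller. The martingale stopped at this approximation is a sum of
    grid increments, each weighted by an event known at the left end of its
    step. *)
Let grid n i : R := s + (t - s) * i%:R / n.+1%:R.

Let grid_step n i : grid n i.+1 = grid n i + (t - s) / n.+1%:R.
Proof. by rewrite /grid -natr1; ring. Qed.

Let step_gt0 n : 0 < (t - s) / n.+1%:R.
Proof. by rewrite divr_gt0// subr_gt0. Qed.

Let grid_ge n i : s <= grid n i.
Proof. by rewrite lerDl divr_ge0// mulr_ge0// subr_ge0 ltW. Qed.

Let grid_le n i : grid n i <= grid n i.+1.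
Proof. by rewrite grid_step lerDl ltW. Qed.

Let grid0 n : grid n 0 = s.
Proof. by rewrite /grid mulr0 mul0r addr0. Qed.

Let gridT n : grid n n.+1 = t.
Proof. by rewrite /grid -mulrA mulfV ?mulr1 ?pnatr_eq0// addrC subrK. Qed.

Let grid_mono n i j : (i <= j)%N -> grid n i <= grid n j.
Proof.
by move=> ij; rewrite lerD2l ler_wpM2r ?invr_ge0// ler_wpM2l ?ler_nat// subr_ge0 ltW.
Qed.

Let grid_ltT n i : (i < n.+1)%N -> grid n i < t.
Proof.
move=> iN; rewrite -[ltRHS](gridT n); apply: lt_le_trans (grid_mono n iN).
by rewrite grid_step ltrDl.
Qed.

Let passed n i : set Omega := [set w | (rho w <= (grid n i)%:E)%E].

Let part n k w : R :=
  M s w + \sum_(i < k) (1 - \1_(passed n i) w) * (M (grid n i.+1) w - M (grid n i) w).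

Let partS n k w : part n k.+1 w =
  part n k w + (1 - \1_(passed n k) w) * (M (grid n k.+1) w - M (grid n k) w).
Proof. by rewrite /part big_ord_recr/= addrA. Qed.

Let passed_real n i w : (i < n.+1)%N ->
  \1_(passed n i) w = (cap t (rho w) <= grid n i)%R%:R :> R.
Proof.
move=> iN; rewrite indicE -(cap_le_fin (rho0 w) (grid_ltT iN)).
by congr (_%:R); congr nat_of_bool; apply/idP/idP; rewrite inE.
Qed.



(** The partial sums are values of the path at a grid point within one step of
    the stopping time, clamped to the part of the grid already visited. *)
Let part_location n k w : (k <= n.+1)%N ->
  exists v, [/\ part n k w = M v w,
    Num.max s (Num.min (grid n k) (cap t (rho w))) <= v, v <= grid n k &
    v <= Num.max s (Num.min (grid n k) (cap t (rho w))) + (t - s) / n.+1%:R].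
Proof.
elim: k => [|k IH] kn.
  exists s; rewrite /part big_ord0 addr0 grid0; split => //.
  - by rewrite ge_max lexx ge_min lexx.
  - by rewrite ler_wpDr ?(ltW (step_gt0 _))// le_max lexx.
have [v [e h1 h2 h3]] := IH (ltnW kn).
rewrite partS passed_real//; have [rk|kr] := leP (cap t (rho w)) (grid n k).
- rewrite (min_r (le_trans rk (grid_le _ _))); rewrite (min_r rk) in h1 h3.
  by exists v; rewrite subrr mul0r addr0; split => //; exact: le_trans (grid_le _ _).
- rewrite (min_l (ltW kr)) (max_r (grid_ge _ _)) in h1 h3.
  have -> : part n k w = M (grid n k) w.
    by rewrite e; congr (M _ w); apply/eqP; rewrite eq_le h2 h1.
  exists (grid n k.+1); rewrite subr0 mul1r addrC subrK; split => //.
  + by rewrite ge_max grid_ge ge_min lexx.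
  + by rewrite {1}grid_step lerD2r le_max le_min grid_le (ltW kr) orbT.
Qed.

Let part_const n i j w : (i <= j <= n.+1)%N -> cap t (rho w) <= grid n i ->
  part n j w = part n i w.
Proof.
move=> /andP[ij jn] ri; elim: j ij jn => [|j IH].
  by rewrite leqn0 => /eqP ->.
rewrite leq_eqVlt => /predU1P[->//|]; rewrite ltnS => ij jn.
rewrite partS IH ?(ltnW jn)// passed_real// (le_trans ri (grid_mono n ij)).
by rewrite subrr mul0r addr0.
Qed.

Let grid_ge0 n i : 0 <= grid n i.
Proof. exact: le_trans (grid_ge _ _). Qed.

Let passed_F n i : F (grid n i) (passed n i).
Proof. by case: hrho => _; apply. Qed.

Let passed_wrt n i : measurable_wrt (F (grid n i)) (\1_(passed n i) : Omega -> R).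
Proof. by apply: measurable_wrt_indic => //; exact: filtration_sigma. Qed.

Let part_wrt n k : measurable_wrt (F (grid n k)) (part n k).
Proof.
elim: k => [|k IH].
  under [X in measurable_wrt _ X]eq_fun do rewrite /part big_ord0 addr0.
  exact: adapted_wrt.
have -> : part n k.+1 = fun w => part n k w +
    (1 - \1_(passed n k) w) * (M (grid n k.+1) w - M (grid n k) w).
  by apply/funext => w; rewrite partS.
have sg := filtration_sigma (grid_ge0 n k.+1).
have mono : F (grid n k) `<=` F (grid n k.+1) by exact: filtration_mono.
apply: measurable_wrtD => //; first exact: measurable_wrtS IH.
apply: measurable_wrtM => //.
  apply: measurable_wrtB => //; first exact: measurable_wrt_cst.
  exact: measurable_wrtS (passed_wrt _ _).
by apply: measurable_wrtB => //; [exact: aM|exact: adapted_wrt].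
Qed.

Let part_measurable n k : measurable_fun setT (part n k).
Proof.
apply: measurable_wrt_measurable (part_wrt n k).
exact: filtration_measurable.
Qed.

Let increment_integ n i : integ P (fun w => M (grid n i.+1) w - M (grid n i) w).
Proof. by apply: integB; exact: martingale_integ. Qed.

(** On the event that [rho] is passed at the [i]-th grid point, the stopped sum
    no longer changes, so that it equals the partial sum at [i] and is known at
    that time. Hence any bounded function of the stopped value is an admissible
    weight for the remaining increments of [M]. *)
Let part_identity n (f : R -> R) (C : R) (B : set Omega) :
  measurable_fun setT f -> (forall x, `|f x| <= C) -> F s B ->
  E (fun w => \1_B w * f (part n n.+1 w) * (M t w - part n n.+1 w)) = 0.
Proof.
move=> mf fC FB.
pose W i w : R := \1_B w * \1_(passed n i) w * f (part n i w).
have eW w : \1_B w * f (part n n.+1 w) * (M t w - part n n.+1 w) =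
    \sum_(i < n.+1) W i w * (M (grid n i.+1) w - M (grid n i) w).
  have -> : M t w - part n n.+1 w =
      \sum_(i < n.+1) \1_(passed n i) w * (M (grid n i.+1) w - M (grid n i) w).
    rewrite /part opprD addrA.
    have -> : M t w - M s w = \sum_(i < n.+1) (M (grid n i.+1) w - M (grid n i) w).
      by rewrite -(big_mkord xpredT (fun i => M (grid n i.+1) w - M (grid n i) w))
        (telescope_sumr (fun i => M (grid n i) w))// gridT grid0.
    by rewrite -sumrB; apply: eq_bigr => i _; ring.
  rewrite mulr_sumr; apply: eq_bigr => i _; rewrite /W passed_real//.
  have [ri|_] := leP (cap t (rho w)) (grid n i); last by rewrite mul0r !mulr0 !mul0r.
  by rewrite (@part_const n i n.+1)//; [ring|rewrite leqnn andbT ltnW].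
under [X in E X]eq_fun do rewrite eW.
have W_wrt i : measurable_wrt (F (grid n i)) (W i).
  have sg := filtration_sigma (grid_ge0 n i).
  apply: measurable_wrtM => //; last exact: measurable_wrt_comp.
  apply: measurable_wrtM => //.
  apply: measurable_wrt_indic => //; apply: filtration_mono FB => //.
have WC i w : `|W i w| <= C.
  rewrite /W !indicE.
  case: (_ \in B); case: (_ \in passed n i);
    rewrite ?mul1r ?mul0r ?mulr0 ?normr0 ?fC// (le_trans _ (fC 0))//.
rewrite (@EP_sum _ _ _ _ _ (fun i w => W i w * (M (grid n i.+1) w - M (grid n i) w))).
  rewrite big1// => i _.
  exact: (martingale_orthogonal hM (grid_ge0 _ _) (grid_le _ _) (W_wrt i) (WC i)).
move=> i _; apply: integMb (WC i) (increment_integ n i).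
apply: measurable_wrt_measurable (W_wrt i).
exact: filtration_measurable.
Qed.

Definition stop_between w : R := M (Num.max s (cap t (rho w))) w.
Local Notation Y := stop_between.

Let part_cvg w : part n n.+1 w @[n --> \oo] --> Y w.
Proof.
have cap_t := cap_le t (rho0 w).
pose p := Num.max s (cap t (rho w)).
have p0 : 0 <= p by rewrite le_max s0.
have := @continuous_nonneg_ext _ (M ^~ w) (@cM w) p.
move=> /cvgrPdist_lt cp; apply/cvgrPdist_lt => e e0.
have /nbhs_ballP[h /= h0 H] := cp _ e0.
have ts0 : 0 < t - s by rewrite subr_gt0.
have hts : 0 < h / (t - s) by rewrite divr_gt0.
have := near_infty_natSinv_lt (PosNum hts); apply: filterS => n /= hn.
have [v [-> h1 h2 h3]] := part_location w (leqnn n.+1).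
move: h1 h3; rewrite gridT (min_r cap_t) -/p => h1 h3.
have v0 : 0 <= v by rewrite (le_trans _ h1).
rewrite /stop_between -/p -{1}(max_l p0) -(max_l v0); apply: H.
rewrite /ball/= distrC ger0_norm ?subr_ge0//.
rewrite ltrBlDl (le_lt_trans h3)// ltrD2l mulrC -ltr_pdivlMr//.
Qed.

Lemma stop_between_wrt : measurable_wrt (F t) Y.
Proof.
have t0 : 0 <= t by rewrite (le_trans s0)// ltW.
apply: (measurable_wrt_cvg (filtration_sigma t0) _ part_cvg) => n.
by have := part_wrt n n.+1; rewrite gridT.
Qed.

Let Y_measurable : measurable_fun setT Y.
Proof.
apply: measurable_wrt_measurable stop_between_wrt.
by apply: filtration_measurable; rewrite (le_trans s0)// ltW.
Qed.

Let Mt_integ : integ P (M t).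
Proof. by apply: martingale_integ => //; rewrite (le_trans s0)// ltW. Qed.

(** The weights [f] make it possible to pass to the limit in [part_identity]
    without uniform integrability: since [f] and [x * f x] are bounded, the
    weighted differences are dominated by [C * `|M t| + C']. *)
Let Y_identity (f : R -> R) (C C' : R) (B : set Omega) :
  continuous f -> (forall x, `|f x| <= C) -> (forall x, `|x * f x| <= C') ->
  F s B -> E (fun w => \1_B w * f (Y w) * (M t w - Y w)) = 0.
Proof.
move=> cf fC fC' FB.
have mf := continuous_measurable_fun cf.
have mB : measurable B by exact: filtration_measurable FB.
have [| | | |_] := @EP_cvg _ _ _ P
  (fun n w => \1_B w * f (part n n.+1 w) * (M t w - part n n.+1 w))
  (fun w => \1_B w * f (Y w) * (M t w - Y w)) (fun w => C * `|M t w| + C').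
- move=> n; apply: measurable_funM.
    apply: measurable_funM; first exact: measurable_indic.
    exact: measurableT_comp.
  by apply: measurable_funB => //; exact: (integ_measurable Mt_integ).
- move=> w; apply: cvgM.
    by apply: cvgMl_tmp; exact: (cvg_continuous_comp cf (@part_cvg w)).
  by apply: cvgB; [exact: cvg_cst|exact: part_cvg].
- apply: integD; last exact: integ_cst.
  by apply: (@integMb _ _ _ _ _ _ `|C|) => //; exact: integ_norm.
- move=> n w; rewrite mulrBr (le_trans (ler_normB _ _))// lerD//.
  + rewrite normrM ler_wpM2r// normrM -[leRHS]mul1r ler_pM//.
    by rewrite indicE; case: (_ \in _); rewrite ?normr1 ?normr0.
  + rewrite -mulrA normrM [f _ * _]mulrC -[leRHS]mul1r ler_pM//.
    by rewrite indicE; case: (_ \in _); rewrite ?normr1 ?normr0.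
- under eq_fun do rewrite (part_identity _ mf fC FB).
  by move=> /(cvg_unique _ (cvg_cst _)) => ->.
Qed.


(** [damp m] is a weight admissible in [Y_identity] which increases to [1]. *)
Let damp (m : nat) (x : R) : R := (1 + `|x| / m.+1%:R)^-1.

Let damp_den m (x : R) : 0 < 1 + `|x| / m.+1%:R.
Proof. by rewrite ltr_pwDl// divr_ge0. Qed.

Let damp_gt0 m x : 0 < damp m x. Proof. by rewrite invr_gt0. Qed.

Let damp_le1 m x : damp m x <= 1.
Proof. by rewrite invf_le1// lerDl divr_ge0. Qed.

Let damp_continuous m : continuous (damp m).
Proof.
move=> x; apply: cvgV; first by rewrite gt_eqF.
apply: cvgD; first exact: cvg_cst.
by apply: cvgMr_tmp; exact: norm_continuous.
Qed.

Let damp_mul m x : `|x * damp m x| <= m.+1%:R.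
Proof.
rewrite normrM (gtr0_norm (damp_gt0 m x)) ler_pdivrMr//.
by rewrite mulrDr mulr1 mulrC divfK ?pnatr_eq0// lerDr.
Qed.

Let damp_cvg x : damp m x @[m --> \oo] --> (1 : R).
Proof.
have -> : (1 : R) = (1 + `|x| * 0)^-1 by rewrite mulr0 addr0 invr1.
apply: cvgV; first by rewrite mulr0 addr0 oner_neq0.
apply: cvgD; first exact: cvg_cst.
by apply: cvgMl_tmp; exact: cvg_harmonic.
Qed.

(** A bounded continuous substitute for the sign of [x]. *)
Let saturate (x : R) : R := x / (1 + `|x|).

Let den1 (x : R) : 0 < 1 + `|x|. Proof. by rewrite ltr_pwDl. Qed.

Let saturate_continuous : continuous saturate.
Proof.
move=> x; apply: cvgM; first exact: cvg_id.
apply: cvgV; first by rewrite gt_eqF.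
by apply: cvgD; [exact: cvg_cst|exact: norm_continuous].
Qed.

Let saturate_le1 x : `|saturate x| <= 1.
Proof.
by rewrite normrM normfV (gtr0_norm (den1 x)) ler_pdivrMr// mul1r lerDr.
Qed.

Let saturate_mul_ge0 x : 0 <= saturate x * x.
Proof. by rewrite mulrAC divr_ge0 ?(ltW (den1 _))// -expr2 sqr_ge0. Qed.

Let norm_le_saturate x : `|x| <= 1 + saturate x * x.
Proof.
rewrite mulrAC -[x * x]expr2 -real_normK ?num_real// -lerBlDl ler_pdivlMr//.
have : 0 <= `|x| by []. by nra.
Qed.

(** Weighting by the damped sign of [Y] gives
    [E (saturate Y * damp m Y * Y) = E (saturate Y * damp m Y * M t) <= E `|M t|];
    Fatou's lemma removes the damping, and [saturate x * x] exceeds [`|x| - 1]. *)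
Let Y_integ : integ P Y.
Proof.
have FT : F s setT.
  by have [h0 hC _] := filtration_sigma s0; rewrite -(setD0 setT); exact: hC.
pose f m x := saturate x * damp m x.
have cf m : continuous (f m).
  by move=> x; apply: cvgM; [exact: saturate_continuous|exact: damp_continuous].
have f1 m x : `|f m x| <= 1.
  by rewrite normrM -[leRHS]mulr1 ler_pM// (gtr0_norm (damp_gt0 _ _)).
have xf m x : `|x * f m x| <= m.+1%:R.
  rewrite /f mulrCA normrM -[leRHS]mul1r ler_pM//.
have mfY m : measurable_fun setT (fun w => f m (Y w)).
  by apply: measurableT_comp => //; exact: continuous_measurable_fun.
have iM m : integ P (fun w => f m (Y w) * M t w).
  exact: (integMb (mfY m) (fun w => f1 m (Y w)) Mt_integ).
have iY m : integ P (fun w => f m (Y w) * Y w).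
  apply: (@integ_bounded _ _ _ _ _ m.+1%:R).
    exact: measurable_funM.
  by move=> w; rewrite mulrC.
have eq m : E (fun w => f m (Y w) * Y w) = E (fun w => f m (Y w) * M t w).
  apply/eqP; rewrite eq_sym -subr_eq0 -EPB//.
  have := @Y_identity (f m) 1 m.+1%:R setT (cf m) (f1 m) (xf m) FT.
  move=> h; apply/eqP; rewrite -[RHS]h; congr EP; apply/funext => w.
  by rewrite indicE mem_set// mul1r mulrBr.
have bound m : E (fun w => f m (Y w) * Y w) <= E (fun w => `|M t w|).
  rewrite eq; apply: le_EP => //; first exact: integ_norm.
  by move=> w; rewrite (le_trans (ler_norm _))// normrM -[leRHS]mul1r ler_wpM2r.
have msY : measurable_fun setT (fun w => saturate (Y w) * Y w).
  apply: measurable_funM => //; apply: measurableT_comp => //.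
  exact: continuous_measurable_fun.
have : (\int[P]_w (saturate (Y w) * Y w)%:E <= (E (fun w => `|M t w|))%:E)%E.
  apply: (@fatou_le _ _ _ P (fun m w => f m (Y w) * Y w)) => //.
  - by move=> n; exact: measurable_funM.
  - apply: aeW => w; apply: cvgMr_tmp; rewrite -[X in _ --> X]mulr1.
    by apply: cvgMl_tmp; exact: damp_cvg.
  - move=> n w; rewrite /f mulrAC mulr_ge0//; exact: ltW.
move=> sY.
have iS : integ P (fun w => saturate (Y w) * Y w).
  apply/integrableP; split; first exact/measurable_EFinP.
  apply: le_lt_trans (ltry (E (fun w => `|M t w|))).
  apply: le_trans sY; rewrite le_eqVlt; apply/orP; left; apply/eqP.
  by apply: eq_integral => w _ /=; rewrite ger0_norm.
apply: (@le_integ _ _ _ _ _ (fun w => 1 + saturate (Y w) * Y w)) => //.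
by apply: integD => //; exact: integ_cst.
Qed.

Let Y_expectation (B : set Omega) : F s B ->
  E (fun w => \1_B w * (M t w - Y w)) = 0.
Proof.
move=> FB; have mB : measurable B by exact: filtration_measurable FB.
have iMY : integ P (fun w => M t w - Y w) by exact: integB.
have [| | | |_] := @EP_cvg _ _ _ P
  (fun m w => \1_B w * damp m (Y w) * (M t w - Y w))
  (fun w => \1_B w * (M t w - Y w)) (fun w => `|M t w - Y w|).
- move=> m; apply: measurable_funM; last exact: integ_measurable iMY.
  apply: measurable_funM; first exact: measurable_indic.
  by apply: measurableT_comp => //; exact: continuous_measurable_fun.
- move=> w; apply: cvgMr_tmp; rewrite -[X in _ --> X]mulr1.
  by apply: cvgMl_tmp; exact: damp_cvg.
- exact: integ_norm.
- move=> m w; rewrite normrM -[leRHS]mul1r ler_wpM2r// normrM -[leRHS]mulr1.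
  rewrite ler_pM// ?(gtr0_norm (damp_gt0 _ _))//.
  by rewrite indicE; case: (_ \in _); rewrite ?normr1 ?normr0.
- under eq_fun => m.
    rewrite (@Y_identity (damp m) 1 m.+1%:R B (@damp_continuous m))//; first over.
      by move=> x; rewrite (gtr0_norm (damp_gt0 _ _)).
  by move=> /(cvg_unique _ (cvg_cst _)) => ->.
Qed.

Lemma stop_between_integ : integ P Y. Proof. exact: Y_integ. Qed.

(** Both [Y] and [M s] have the same expectation as [M t] on the events of
    [F s]. *)
Lemma stop_between_expectation (B : set Omega) : F s B ->
  E (fun w => \1_B w * (Y w - M s w)) = 0.
Proof.
move=> FB; have mB : measurable B by exact: filtration_measurable FB.
have ib D : integ P D -> integ P (fun w => \1_B w * D w).
  move=> iD; apply: (@integMb _ _ _ _ _ _ 1) => // w.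
  by rewrite indicE; case: (_ \in _); rewrite ?normr1 ?normr0.
have -> : (fun w => \1_B w * (Y w - M s w)) =
    fun w => \1_B w * (M t w - M s w) - \1_B w * (M t w - Y w).
  by apply/funext => w; ring.
have Ms : integ P (M s) by exact: martingale_integ.
rewrite EPB ?Y_expectation ?subr0//; [|exact/ib/integB|exact/ib/integB].
apply: (@martingale_orthogonal _ _ _ _ 1 hM) => //; first exact: ltW.
  by apply: measurable_wrt_indic => //; exact: filtration_sigma.
by move=> w; rewrite indicE; case: (_ \in _); rewrite ?normr1 ?normr0.
Qed.

End interval.

(** The increment of the stopped process between [s] and [t] is
    [stop_between s t - M s]. *)
Lemma martingale_stopped : martingale P F (stopped rho M).
Proof.
have stop0 t w : 0 <= t -> stopped rho M t w = stop_between 0 t w.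
  by move=> t0; rewrite /stopped /stop_between max_r// cap_ge0.
have stop00 w : stopped rho M 0 w = M 0 w.
  rewrite /stopped -/(cap 0 (rho w)); congr (M _ w).
  by apply/eqP; rewrite eq_le cap_le// cap_ge0.
apply: martingale_of_orthogonal.
- move=> t; rewrite le_eqVlt => /predU1P[<-|t0].
    by rewrite (funext stop00); exact: aM.
  have -> : stopped rho M t = stop_between 0 t by apply/funext => w; rewrite stop0// ltW.
  exact: stop_between_wrt.
- move=> t; rewrite le_eqVlt => /predU1P[<-|t0].
    by rewrite (funext stop00); exact: martingale_integ.
  have -> : stopped rho M t = stop_between 0 t by apply/funext => w; rewrite stop0// ltW.
  exact: stop_between_integ.
- move=> s t B s0; rewrite le_eqVlt => /predU1P[<-|st] FB.
    by under [X in E X]eq_fun do rewrite subrr mulr0; exact: EP_cst.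
  rewrite -[RHS](stop_between_expectation s0 st FB); congr EP; apply/funext => w.
  congr (_ * _); rewrite /stopped /stop_between -!/(cap _ _).
  rewrite (cap_min (ltW st) (rho0 w)).
  by have [h|h] := leP s (cap t (rho w)); rewrite ?subrr.
Qed.

End stop.
End optional_stopping.

(** * Hitting times *)

Section hitting.
Context (d : measure_display) (Omega : measurableType d) (R : realType).
Context (F : R -> set (set Omega)).
Hypothesis hF : is_filtration F.
Implicit Types (s t u : R) (tau sigma : Omega -> \bar R).

Lemma stopping_time_min tau sigma : stopping_time F tau ->
  stopping_time F sigma -> stopping_time F (fun w => mine (tau w) (sigma w)).
Proof.
move=> [t0 ht] [s0 hs]; split=> [w|t t_ge0]; first by rewrite le_min t0 s0.
have sF := filtration_sigma hF t_ge0.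
have E : @measurable _ (g_sigma_algebraType (F t)) = F t.
  exact: measurable_g_measurableTypeE.
have -> : [set w | (mine (tau w) (sigma w) <= t%:E)%E] =
    [set w | (tau w <= t%:E)%E] `|` [set w | (sigma w <= t%:E)%E].
  apply/seteqP; split=> w /=; first by rewrite ge_min => /orP.
  by move=> /orP; rewrite -ge_min.
by rewrite -E; apply: measurableU; rewrite E; [exact: ht|exact: hs].
Qed.

Definition hitting_time (G : R -> Omega -> R) (k : R) (w : Omega) : \bar R :=
  ereal_inf [set u%:E | u in [set u : R | 0 <= u /\ k <= G u w]].

Context (G : R -> Omega -> R) (k : R).
Hypotheses (aG : adapted F G) (cG : forall w, continuous (G ^~ w)).

Let near_lt u w (l : R) : l < G u w ->
  exists2 e, 0 < e & forall v, `|v - u| < e -> l < G v w.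
Proof.
move=> lG; have d0 : 0 < G u w - l by rewrite subr_gt0.
have /cvgrPdist_lt/(_ _ d0)/nbhs_ballP[e /= e0 H] := @cG w u.
exists e => // v vu; have := H v.
rewrite /ball/= distrC => /(_ vu) h.
by have := le_lt_trans (ler_norm _) h; rewrite ltrD2l ltrN2.
Qed.

(** The infimum is attained because the path is continuous: if [G] stays below
    [k] up to [t], it does so a little longer. *)
Lemma hitting_time_leP t w : 0 <= t ->
  (hitting_time G k w <= t%:E)%E <-> exists2 u, 0 <= u <= t & k <= G u w.
Proof.
move=> t0; split; last first.
  move=> [u /andP[u0 ut] kG]; apply: (@le_trans _ _ u%:E); last by rewrite lee_fin.
  by apply: ereal_inf_lbound; exists u.
move=> ht; apply: contrapT => hn.
have Gk u : 0 <= u <= t -> G u w < k.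
  by move=> ut; rewrite ltNge; apply/negP => h; apply: hn; exists u.
have /Gk Gt : 0 <= t <= t by rewrite t0 lexx.
have [e e0 H] : exists2 e, 0 < e & forall v, `|v - t| < e -> G v w < k.
  have d0 : 0 < k - G t w by rewrite subr_gt0.
  have /cvgrPdist_lt/(_ _ d0)/nbhs_ballP[e /= e0 H] := @cG w t.
  exists e => // v vu; have := H v; rewrite /ball/= distrC => /(_ vu) h.
  rewrite distrC in h.
  by have := le_lt_trans (ler_norm _) h; rewrite ltrD2r.
have : ((t + e)%:E <= hitting_time G k w)%E.
  apply: le_ereal_inf_tmp => _ [u [u0 kG] <-]; rewrite lee_fin leNgt; apply/negP => ute.
  have [ut|tu] := leP u t.
    by have := Gk u; rewrite u0 ut => /(_ isT); rewrite ltNge kG.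
  by have := H u; rewrite gtr0_norm ?subr_gt0// ltrBlDl => /(_ ute); rewrite ltNge kG.
by move=> /le_trans/(_ ht); rewrite lee_fin gerDl leNgt e0.
Qed.

(** A continuous path reaches the level [k] on a compact interval if and only if
    it exceeds [k - 1 / (m + 1)] at some rational time for every [m]; this is a
    countable condition known at time [t]. The rational times are clamped at [t]
    because [t] itself may be the only hitting time. *)
Lemma hitting_time_stopping : stopping_time F (hitting_time G k).
Proof.
split=> [w|t t0].
  by apply: le_ereal_inf_tmp => _ [u [u0 _] <-]; rewrite lee_fin.
have sF := filtration_sigma hF t0.
have E : @measurable _ (g_sigma_algebraType (F t)) = F t.
  exact: measurable_g_measurableTypeE.
have -> : [set w | (hitting_time G k w <= t%:E)%E] =
    \bigcap_m \bigcup_q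
      [set w | k - m.+1%:R^-1 < G (Num.min t `|ratr q : R|) w].
  apply/seteqP; split=> w /=.
    move=> /(hitting_time_leP _ t0)[u /andP[u0 ut] kG] m _.
    have [|e e0 H] := @near_lt u w (k - m.+1%:R^-1).
      by rewrite (lt_le_trans _ kG)// ltrBlDr ltrDl invr_gt0.
    have [|q] := @rat_in_itvoo R u (u + e); first by rewrite ltrDl.
    rewrite in_itv/= => /andP[uq qe].
    exists q => //=; apply: H.
    have q0 : 0 <= (ratr q : R) by rewrite (le_trans u0)// ltW.
    rewrite (ger0_norm q0) ger0_norm ?subr_ge0 ?le_min ?ut ?(ltW uq)//.
    by rewrite ltrBlDl (le_lt_trans _ qe)// ge_min lexx orbT.
  move=> H; apply/(hitting_time_leP _ t0).
  have [u ut Hu] := EVT_max t0 (continuous_subspaceT (@cG w)).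
  exists u; first by rewrite in_itv/= in ut.
  apply/ler_addgt0Pr => e e0.
  have [m _] := near_infty_natSinv_lt (PosNum e0) => /(_ m (leqnn m)) /= me.
  have [q _ /= Hq] := H m I.
  have : G (Num.min t `|ratr q|) w <= G u w.
    by apply: Hu; rewrite in_itv/= ge_min lexx le_min t0/= normr_ge0.
  move=> /(lt_le_trans Hq); rewrite ltrBlDr => h.
  by rewrite (le_trans (ltW h))// lerD2l ltW.
rewrite -E; apply: bigcapT_measurable => m; apply: bigcupT_measurable_rat => q.
rewrite E; set u := Num.min _ _.
have -> : [set w | k - m.+1%:R^-1 < G u w] = G u @^-1` `]k - m.+1%:R^-1, +oo[.
  by apply/seteqP; split=> w /=; rewrite in_itv/= andbT.
have u0 : 0 <= u by rewrite le_min t0/= normr_ge0.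
have ut : u <= t by rewrite ge_min lexx.
by apply: (adapted_wrt hF aG u0 ut); exact: measurable_itv.
Qed.

Lemma hitting_time_bound u w : G 0 w <= k -> 0 <= u ->
  (u%:E <= hitting_time G k w)%E -> G u w <= k.
Proof.
move=> G0; rewrite le_eqVlt => /predU1P[<-//|u0] uh.
rewrite leNgt; apply/negP => kG.
have [e e0 H] := near_lt kG.
pose v := Num.max 0 (u - e / 2).
have vu : v < u by rewrite gt_max u0 ltrBlDr ltrDl divr_gt0.
have v0 : 0 <= v by rewrite le_max lexx.
have : (hitting_time G k w <= v%:E)%E.
  apply/(hitting_time_leP _ v0); exists v; first by rewrite v0 lexx.
  apply/ltW/H; rewrite distrC gtr0_norm ?subr_gt0//.
  rewrite ltrBlDl -ltrBlDr lt_max orbC ler_ltB//.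
  by rewrite ltr_pdivrMr// ltr_pMr// ltr1n.
by move=> /(le_trans uh); rewrite lee_fin leNgt vu.
Qed.

Lemma hitting_time_pinfty w : (forall u, 0 <= u -> G u w < k) ->
  hitting_time G k w = +oo%E.
Proof.
move=> H; rewrite /hitting_time (_ : [set u | _] = set0) ?image_set0 ?ereal_inf0//.
by apply/seteqP; split=> u //= [u0]; rewrite leNgt H.
Qed.

End hitting.

Lemma continuous_maxr (R : realType) (f g : R -> R) : continuous f ->
  continuous g -> continuous (fun u => Num.max (f u) (g u)).
Proof.
by move=> cf cg u; apply: (@continuous_max _ _ f g); [exact: cf|exact: cg].
Qed.

Lemma bigmax_continuous (R : realType) (N : nat) (Y : nat -> R -> R) :
  (forall i, continuous (Y i)) ->
  continuous (fun u => \big[Num.max/0]_(i < N) Y i u).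
Proof.
elim: N Y => [|N IH] Y cY.
  rewrite (_ : (fun u => _) = cst 0); first by move=> u; exact: cvg_cst.
  by apply/funext => u; rewrite big_ord0.
rewrite (_ : (fun u => _) =
    fun u => Num.max (Y 0%N u) (\big[Num.max/0]_(i < N) Y i.+1 u)); last first.
  by apply/funext => u; rewrite big_ord_recl.
by apply: continuous_maxr; [exact: cY|exact: (IH (fun i => Y i.+1))].
Qed.

Lemma measurable_wrt_bigmax (d : measure_display) (Omega : measurableType d)
    (R : realType) (G : set (set Omega)) (N : nat) (Y : nat -> Omega -> R) :
  sigma_algebra setT G -> (forall i, measurable_wrt G (Y i)) ->
  measurable_wrt G (fun w => \big[Num.max/0]_(i < N) Y i w).
Proof.
move=> sG; elim: N Y => [|N IH] Y mY.
  rewrite (_ : (fun w => _) = fun=> 0); first exact: measurable_wrt_cst.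
  by apply/funext => u; rewrite big_ord0.
rewrite (_ : (fun w => _) =
    fun w => Num.max (Y 0%N w) (\big[Num.max/0]_(i < N) Y i.+1 w)); last first.
  by apply/funext => u; rewrite big_ord_recl.
apply: measurable_wrt_max => //.
exact: (IH (fun i => Y i.+1)).
Qed.

(** * Pathwise integrals *)

Lemma abel_summation (R : realType) (T : R) (s x : nat -> R) (N : nat) :
  \sum_(i < N) (T - s i) * (x i.+1 - x i) =
  (T - s N) * x N - (T - s 0%N) * x 0%N + \sum_(i < N) x i.+1 * (s i.+1 - s i).
Proof.
elim: N => [|N IH]; first by rewrite !big_ord0 subrr addr0.
by rewrite !big_ord_recr/= IH; ring.
Qed.

Section path_integrals.
Context {R : realType}.
Implicit Types (f : R -> R) (b : R).

Lemma Rintegral_lebesgue_nonneg_ext f b : {within `[0, +oo[, continuous f} ->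
  (\int[lebesgue_measure]_(u in `[0, b]) f u =
   \int[lebesgue_stieltjes_measure idfun]_(u in `]0, b]) f (Num.max u 0))%R.
Proof.
move=> cf.
transitivity (\int[lebesgue_measure]_(u in `[0, b]) f (Num.max u 0))%R.
  apply: eq_Rintegral => u; rewrite inE/= in_itv/= => /andP[u0 _].
  by rewrite max_l.
rewrite -Rintegral_itv_obnd_cbnd//.
exact: (integrable_itvoc_continuous idfun 0 b (continuous_nonneg_ext cf)).
Qed.

Lemma lebesgue_riemann_cvg f b (K : R) (N : nat -> nat) (u : nat -> nat -> R) :
  {within `[0, +oo[, continuous f} -> 0 <= b -> 0 <= K ->
  (\forall n \near \oo, [/\ u n 0%N = 0, u n (N n) = b &
    forall i, (i < N n)%N -> u n i <= u n i.+1 /\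
                        u n i.+1 - u n i <= K / n.+1%:R]) ->
  \sum_(i < N n) f (Num.max (u n i.+1) 0) * (u n i.+1 - u n i) @[n --> \oo] -->
    (\int[lebesgue_measure]_(u in `[0, b]) f u)%R.
Proof.
move=> cf b0 K0 H; rewrite Rintegral_lebesgue_nonneg_ext//.
apply: (@stieltjes_riemann_cvg _ idfun (fun x => f (Num.max x 0)) 0 b K N u
  (fun n i => u n i.+1)) => //.
  exact: continuous_nonneg_ext.
apply: filterS H => n [h1 h2 h3]; split => // i iN.
by have [h4 h5] := h3 _ iN; rewrite h4 lexx.
Qed.

(** The discrete form of integration by parts: the sums which approximate the
    stochastic integral of [b - u] are, path by path, Riemann sums of [f]. *)
Lemma grid_abel_cvg f b : {within `[0, +oo[, continuous f} -> 0 < b ->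
  \sum_(i < n.+1) (b - b * i%:R / n.+1%:R) *
     (f (b * i.+1%:R / n.+1%:R) - f (b * i%:R / n.+1%:R)) @[n --> \oo] -->
  (\int[lebesgue_measure]_(u in `[0, b]) f u)%R - b * f 0.
Proof.
move=> cf b0.
have E n : \sum_(i < n.+1) (b - b * i%:R / n.+1%:R) *
     (f (b * i.+1%:R / n.+1%:R) - f (b * i%:R / n.+1%:R)) =
   \sum_(i < n.+1) f (Num.max (b * i.+1%:R / n.+1%:R) 0) *
     (b * i.+1%:R / n.+1%:R - b * i%:R / n.+1%:R) - b * f 0.
  rewrite (abel_summation b (fun i => b * i%:R / n.+1%:R)
    (fun i => f (b * i%:R / n.+1%:R))).
  rewrite -[b * n.+1%:R / _]mulrA mulfV ?pnatr_eq0// mulr1 subrr mul0r add0r.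
  rewrite mulr0 mul0r subr0 addrC; congr (_ - _); apply: eq_bigr => i _.
  by rewrite max_l// divr_ge0// mulr_ge0// ltW.
under eq_fun do rewrite E.
apply: cvgB; last exact: cvg_cst.
apply: (@lebesgue_riemann_cvg f b b (fun n => n.+1)
  (fun n i => b * i%:R / n.+1%:R)) => //; [exact: ltW|exact: ltW|].
apply: nearW => n; split.
- by rewrite mulr0 mul0r.
- by rewrite -mulrA mulfV ?mulr1// pnatr_eq0.
- move=> i _; split.
    by rewrite ler_pM2r ?invr_gt0// ler_wpM2l ?(ltW b0)// ler_nat.
  by rewrite -mulrBl -mulrBr -natrB// subSnn mulr1.
Qed.

Lemma stieltjes_square_weight (Q : cumulative R R) b : continuous Q -> 0 < b ->
  (\int[lebesgue_stieltjes_measure Q]_(u in `[0%R, b]) ((b - u) ^+ 2)%:E =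
   (\int[lebesgue_stieltjes_measure Q]_(u in `]0, b]) (b - u) ^+ 2)%R%:E)%E.
Proof.
move=> cQ b0.
have cg : continuous (fun u : R => (b - u) ^+ 2).
  move=> u; apply: cvgM; (apply: cvgB; [exact: cvg_cst|exact: cvg_id]).
rewrite integral_itvcc_itvoc; first last.
- by move=> x; exact: sqr_ge0.
- by apply: measurable_funTS; exact: continuous_measurable_fun.
- exact: ltW.
- exact: cQ.
rewrite fineK//; apply: integrable_fin_num; first exact: measurable_itv.
exact: integrable_itvoc_continuous.
Qed.

Lemma grid_square_weight_cvg (Q : cumulative R R) b : 0 < b ->
  \sum_(i < n.+1) (b - b * i%:R / n.+1%:R) ^+ 2 *
     (Q (b * i.+1%:R / n.+1%:R) - Q (b * i%:R / n.+1%:R)) @[n --> \oo] -->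
  (\int[lebesgue_stieltjes_measure Q]_(u in `]0, b]) (b - u) ^+ 2)%R.
Proof.
move=> b0.
have cg : continuous (fun u : R => (b - u) ^+ 2).
  move=> u; apply: cvgM; (apply: cvgB; [exact: cvg_cst|exact: cvg_id]).
exact: (@grid_stieltjes_cvg _ Q (fun u => (b - u) ^+ 2) b cg (ltW b0)).
Qed.

End path_integrals.

Section measurability.
Context (d : measure_display) (Omega : measurableType d) (R : realType).
Context (F : R -> set (set Omega)) (hF : is_filtration F).
Context (X : R -> Omega -> R) (QX : Omega -> cumulative R R).
Hypotheses (aX : adapted F X) (cX : continuous_paths X).
Hypothesis (aQ : adapted F (fun t w => QX w t)).

(** The path integrals of this section are pointwise limits of grid sums, which are
    measurable because their terms are values of adapted processes. *)
Lemma measurable_integral_path b : 0 <= b ->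
  measurable_fun setT (fun w => (\int[lebesgue_measure]_(u in `[0, b]) X u w)%R).
Proof.
rewrite le_eqVlt => /predU1P[<-|b0].
  rewrite (_ : (fun w => _) = fun=> 0)//; apply/funext => w.
  by rewrite set_itv1 Rintegral_set1.
have mX t : 0 <= t -> measurable_fun setT (X t) := adapted_measurable hF aX.
rewrite (_ : (fun w => _) = fun w =>
    ((\int[lebesgue_measure]_(u in `[0, b]) X u w)%R - b * X 0 w) + b * X 0 w); last first.
  by apply/funext => w; rewrite subrK.
apply: measurable_funD; last by apply: measurable_funM => //; exact: mX.
apply: (measurable_fun_cvg (h := fun n w => \sum_(i < n.+1) (b - b * i%:R / n.+1%:R) *
     (X (b * i.+1%:R / n.+1%:R) w - X (b * i%:R / n.+1%:R) w))).
  move=> n; apply: measurable_sum => i; apply: measurable_funM => //.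
  by apply: measurable_funB; apply: mX; rewrite divr_ge0// mulr_ge0// ltW.
by move=> w _; exact: (@grid_abel_cvg _ (X ^~ w) b (@cX w) b0).
Qed.

Lemma measurable_stieltjes_continuous (g : R -> R) a b : continuous g ->
  0 <= a -> a <= b -> measurable_fun setT (fun w =>
    (\int[lebesgue_stieltjes_measure (QX w)]_(u in `]a, b]) g u)%R).
Proof.
move=> cg a0 ab; pose u n i : R := a + (b - a) * i%:R / n.+1%:R.
have mQ t : 0 <= t -> measurable_fun setT (fun w => QX w t) := adapted_measurable hF aQ.
have ba : 0 <= b - a by rewrite subr_ge0.
have u0 n i : 0 <= u n i by rewrite addr_ge0// divr_ge0// mulr_ge0.
apply: (measurable_fun_cvg (h := fun n w => \sum_(i < n.+1) g (u n i) *
     (QX w (u n i.+1) - QX w (u n i)))).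
  move=> n; apply: measurable_sum => i; apply: measurable_funM => //.
  by apply: measurable_funB; exact: mQ.
move=> w _.
apply: (@stieltjes_riemann_cvg _ (QX w) g a b (b - a) (fun n => n.+1) u u) => //.
apply: nearW => n; split.
- by rewrite /u mulr0 mul0r addr0.
- by rewrite /u -mulrA mulfV ?pnatr_eq0// mulr1 addrC subrK.
- move=> i _; have e : u n i.+1 - u n i = (b - a) / n.+1%:R.
    by rewrite /u -natr1; ring.
  split; last by rewrite e.
  by rewrite lexx -subr_ge0 e divr_ge0.
Qed.

Lemma measurable_stieltjes_square_weight b : 0 < b ->
  measurable_fun setT (fun w =>
    (\int[lebesgue_stieltjes_measure (QX w)]_(u in `]0, b]) (b - u) ^+ 2)%R).
Proof.
move=> b0; apply: (@measurable_stieltjes_continuous (fun u => (b - u) ^+ 2)) => //.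
  move=> u; apply: cvgM; (apply: cvgB; [exact: cvg_cst|exact: cvg_id]).
exact: ltW.
Qed.

End measurability.

(** * The exponential supermartingale on a grid *)

Section exponential_step.
Context (d : measure_display) (Omega : measurableType d) (R : realType).
Context (P : probability Omega R) (F : R -> set (set Omega)).
Hypothesis hF : is_filtration F.
Local Notation E := (EP P).
(** [N] is the stopped local martingale, [V] its stopped bracket and [x0] the
    initial value, only almost surely zero; the stopping makes the increments of
    [N] and [V] over the grid [t] bounded. *)
Context (N V : R -> Omega -> R) (x0 : Omega -> R).
Hypothesis x0_wrt : measurable_wrt (F 0) x0.
Hypothesis hL : martingale P F (fun t w => N t w - x0 w).
Hypothesis hW : martingale P F (fun t w => N t w ^+ 2 - V t w - x0 w ^+ 2).
Context (n : nat) (t a : nat -> R) (b k c eta : R).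
Hypothesis t0 : t 0%N = 0.
Hypothesis tS : forall i, t i <= t i.+1.
Hypothesis N0 : forall w, N 0 w = x0 w.
Hypothesis b_ge0 : 0 <= b.
Hypothesis eta_ge0 : 0 <= eta.
Hypothesis hexp : forall x q : R, `|x| <= k -> 0 <= q -> q <= k ->
    expR (x - b * q) <= 1 + x + c * (x ^+ 2 - q).
Hypothesis incN : forall i w, (i < n)%N -> `|N (t i.+1) w - N (t i) w| <= eta.
Hypothesis incNk : forall i w, (i < n)%N -> `|a i * (N (t i.+1) w - N (t i) w)| <= k.
Hypothesis incV0 : forall i w, (i < n)%N -> 0 <= V (t i.+1) w - V (t i) w.
Hypothesis incVk : forall i w, (i < n)%N -> a i ^+ 2 * (V (t i.+1) w - V (t i) w) <= k.

Let y i w : R := a i * (N (t i.+1) w - N (t i) w) -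
  b * (a i ^+ 2 * (V (t i.+1) w - V (t i) w)).

Let start : set Omega := [set w | x0 w = 0].

(** Restricting to paths which start at [0] makes [N] bounded on the grid, hence
    allowed as a weight below. *)
Definition exp_process j w : R := \1_start w * expR (\sum_(i < j) y i w).
Local Notation Z := exp_process.

Let t_ge0 i : 0 <= t i.
Proof. by elim: i => [|i IH]; rewrite ?t0// (le_trans IH). Qed.

Let sF s : 0 <= s -> sigma_algebra setT (F s).
Proof. exact: filtration_sigma. Qed.

Let x0_wrt' s : 0 <= s -> measurable_wrt (F s) x0.
Proof. by move=> s0; apply: measurable_wrtS x0_wrt; exact: filtration_mono. Qed.

Let N_wrt s : 0 <= s -> measurable_wrt (F s) (N s).
Proof.
move=> s0; have [aL _ _] := hL.
rewrite (_ : N s = fun w => (N s w - x0 w) + x0 w); last first.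
  by apply/funext => w; rewrite subrK.
by apply: measurable_wrtD (aL _ s0) (x0_wrt' s0); exact: sF.
Qed.

Let V_wrt s : 0 <= s -> measurable_wrt (F s) (V s).
Proof.
move=> s0; have [aW _ _] := hW.
have e : V s = fun w => (N s w * N s w - x0 w * x0 w) - (N s w ^+ 2 - V s w - x0 w ^+ 2).
  by apply/funext => w; ring.
rewrite e; apply: (measurable_wrtB (sF s0) _ (aW _ s0)).
apply: measurable_wrtB => //; [exact: sF| |].
- by apply: measurable_wrtM; [exact: sF|exact: N_wrt|exact: N_wrt].
- by apply: measurable_wrtM; [exact: sF|exact: x0_wrt'|exact: x0_wrt'].
Qed.

Let t_mono i j : (i <= j)%N -> t i <= t j.
Proof.
elim: j => [|j IH]; first by rewrite leqn0 => /eqP ->.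
rewrite leq_eqVlt => /predU1P[->//|]; rewrite ltnS => /IH/le_trans; exact.
Qed.

Let N_wrt_le s s' : 0 <= s -> s <= s' -> measurable_wrt (F s') (N s).
Proof. by move=> s0 ss'; apply: measurable_wrtS (N_wrt s0); exact: filtration_mono. Qed.

Let V_wrt_le s s' : 0 <= s -> s <= s' -> measurable_wrt (F s') (V s).
Proof. by move=> s0 ss'; apply: measurable_wrtS (V_wrt s0); exact: filtration_mono. Qed.

Let start_wrt s : 0 <= s -> measurable_wrt (F s) (\1_start : Omega -> R).
Proof.
move=> s0; apply: measurable_wrt_indic; first exact: sF.
rewrite (_ : start = x0 @^-1` [set 0])//.
by apply: x0_wrt' => //; exact: measurable_set1.
Qed.

Let y_wrt i j : (i < j)%N -> measurable_wrt (F (t j)) (y i).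
Proof.
move=> ij; have st := sF (t_ge0 j).
have h (r : R) (f : Omega -> R) : measurable_wrt (F (t j)) f ->
    measurable_wrt (F (t j)) (fun w => r * f w).
  by move=> mf; apply: measurable_wrtM => //; exact: measurable_wrt_cst.
apply: measurable_wrtB => //; last apply: (h); apply: (h); apply: measurable_wrtB => //.
- by apply: N_wrt_le => //; exact: t_mono.
- by apply: N_wrt_le => //; apply: t_mono; exact: ltnW.
- by apply: V_wrt_le => //; exact: t_mono.
- by apply: V_wrt_le => //; apply: t_mono; exact: ltnW.
Qed.

Let Z_wrt j : measurable_wrt (F (t j)) (Z j).
Proof.
have st := sF (t_ge0 j).
apply: measurable_wrtM => //; first exact: start_wrt.
apply: (@measurable_wrt_comp _ _ _ _ st (fun w => \sum_(i < j) y i w) expR).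
  exact: measurable_expR.
by apply: (measurable_wrt_sum st (f := y)) => i ij; exact: y_wrt.
Qed.

Let Z_ge0 j w : 0 <= Z j w.
Proof. by rewrite /exp_process mulr_ge0 ?expR_ge0// indicE. Qed.

Let Z_le j w : (j <= n)%N -> `|Z j w| <= expR (k *+ j).
Proof.
move=> jn; rewrite ger0_norm// /exp_process -[leRHS]mul1r ler_pM ?expR_ge0//.
rewrite ler_expR; apply: (@le_trans _ _ (\sum_(i < j) k)); last first.
  by rewrite sumr_const card_ord.
apply: ler_sum => i _; have iN : (i < n)%N by rewrite (leq_trans _ jn).
rewrite /y lerBlDr (le_trans (ler_norm _))// (le_trans (incNk _ iN))// lerDl.
by apply: mulr_ge0 => //; apply: mulr_ge0; [exact: sqr_ge0|exact: incV0].
Qed.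

Let start_N j w : (j <= n)%N -> \1_start w * `|N (t j) w| <= eta *+ j.
Proof.
rewrite indicE; have [/set_mem/= w0|_] := boolP (w \in start); last first.
  by move=> _; rewrite mul0r mulrn_wge0.
elim: j => [|j IH] jn; first by rewrite mul1r t0 N0 w0 normr0.
rewrite mul1r mulrSr; rewrite mul1r in IH.
rewrite -[N _ _](subrK (N (t j) w)) addrC (le_trans (ler_normD _ _))// lerD//.
  exact/IH/ltnW.
exact: incN.
Qed.

Lemma integ_exp_process j : (j <= n)%N -> integ P (Z j).
Proof.
move=> jn; apply: (@integ_bounded _ _ _ _ _ (expR (k *+ j))).
  by apply: measurable_wrt_measurable (Z_wrt j); exact: filtration_measurable.
by move=> w; exact: Z_le.
Qed.

(** By [hexp], [Z j.+1] is at most [Z j * (1 + x + c * (x ^+ 2 - q))] where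
    [x = a j * (N (t j.+1) - N (t j))] and [q = a j ^+ 2 * (V (t j.+1) - V (t j))].
    Up to the factor [a j ^+ 2], [x ^+ 2 - q] is the increment [dW] of
    [N ^+ 2 - V] minus [2 * N (t j)] times the increment of [N]; so the excess
    over [Z j] is a combination of [dL] and [dW] with the weights [A1] and [A2],
    known at time [t j]. *)
Let Z_step j : (j < n)%N -> E (Z j.+1) <= E (Z j).
Proof.
move=> jn.
pose dL w : R := (N (t j.+1) w - x0 w) - (N (t j) w - x0 w).
pose dW w : R := (N (t j.+1) w ^+ 2 - V (t j.+1) w - x0 w ^+ 2)
               - (N (t j) w ^+ 2 - V (t j) w - x0 w ^+ 2).
pose A1 w : R := Z j w * (a j) - Z j w * (2 * c * a j ^+ 2) * (\1_start w * N (t j) w).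
pose A2 w : R := Z j w * (c * a j ^+ 2).
have st := sF (t_ge0 j).
have cw (r : R) : measurable_wrt (F (t j)) (fun _ : Omega => r) by exact: measurable_wrt_cst.
have A1_wrt : measurable_wrt (F (t j)) A1.
  apply: measurable_wrtB => //; first exact: measurable_wrtM.
  apply: measurable_wrtM => //; first exact: measurable_wrtM.
  apply: measurable_wrtM => //; first exact: start_wrt.
  exact: N_wrt.
have A2_wrt : measurable_wrt (F (t j)) A2 by exact: measurable_wrtM.
set Cj := expR (k *+ j).
have ZC w : `|Z j w| <= Cj by apply: Z_le; exact: ltnW.
have A2C w : `|A2 w| <= Cj * `|c * a j ^+ 2| by rewrite normrM ler_wpM2r.
have A1C w : `|A1 w| <= Cj * `|a j| + Cj * `|2 * c * a j ^+ 2| * (eta *+ j).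
  rewrite (le_trans (ler_normB _ _))// lerD// normrM ?ler_wpM2r//.
  rewrite ler_pM//; first by rewrite normrM ler_wpM2r.
  rewrite normrM [`|\1_start w|]ger0_norm ?indicE//.
  by have := @start_N j w (ltnW jn); rewrite indicE.
have EL : E (fun w => A1 w * dL w) = 0.
  exact: (martingale_orthogonal hF hL (t_ge0 j) (tS j) A1_wrt A1C).
have EW : E (fun w => A2 w * dW w) = 0.
  exact: (martingale_orthogonal hF hW (t_ge0 j) (tS j) A2_wrt A2C).
have iL : integ P (fun w => A1 w * dL w).
  apply: (integMb _ A1C).
    by apply: measurable_wrt_measurable A1_wrt; exact: filtration_measurable.
  by apply: integB; exact: martingale_integ hL _.
have iW : integ P (fun w => A2 w * dW w).
  apply: (integMb _ A2C).
    by apply: measurable_wrt_measurable A2_wrt; exact: filtration_measurable.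
  by apply: integB; exact: martingale_integ hW _.
have iZ := integ_exp_process (ltnW jn).
have -> : E (Z j) = E (fun w => Z j w + A1 w * dL w + A2 w * dW w).
  by rewrite EPD// ?EPD// ?EL ?EW ?addr0//; exact: integD.
apply: le_EP; [exact: integ_exp_process|by do 2?[apply: integD => //]|].
move=> w.
have -> : Z j.+1 w = Z j w * expR (y j w).
  by rewrite /exp_process big_ord_recr/= expRD mulrA.
have h := hexp (incNk w jn) (mulr_ge0 (sqr_ge0 (a j)) (incV0 w jn)) (incVk w jn).
apply: (le_trans (ler_wpM2l (Z_ge0 j w) h)).
rewrite le_eqVlt; apply/orP; left; apply/eqP.
rewrite /A1 /A2 /dL /dW.
have -> : Z j w * (2 * c * a j ^+ 2) * (\1_start w * N (t j) w) =
    Z j w * (2 * c * a j ^+ 2) * N (t j) w.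
  rewrite /exp_process indicE; case: (_ \in _) => /=; ring.
by ring.
Qed.

Lemma exp_process_le1 : E (Z n) <= 1.
Proof.
have : forall j, (j <= n)%N -> E (Z j) <= 1.
  elim=> [_|j IH jn]; last by rewrite (le_trans (Z_step jn))// IH// ltnW.
  rewrite -[leRHS](EP_cst P); apply: le_EP; [exact: integ_exp_process|exact: integ_cst|].
  move=> w; rewrite /exp_process big_ord0 expR0 mulr1 indicE.
  by case: (_ \in _).
exact.
Qed.

End exponential_step.

(** * The exponential bound *)

Section exponential_bound.
Context (d : measure_display) (Omega : measurableType d) (R : realType).
Context (P : probability Omega R) (F : R -> set (set Omega)).
Hypothesis hF : is_filtration F.
Local Notation E := (EP P).
Context (X : R -> Omega -> R) (QX : Omega -> cumulative R R).
Hypotheses (aX : adapted F X) (cX : continuous_paths X).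
Hypothesis hX0 : {ae P, forall w, X 0 w = 0}.
Hypothesis Q0 : forall w t, t <= 0 -> QX w t = 0.
Hypothesis cQ : forall w, continuous (QX w).
Hypothesis aQ : adapted F (fun t w => QX w t).
Context (tau sig : nat -> Omega -> \bar R).
Hypothesis tau_stop : forall n, stopping_time F (tau n).
Hypothesis sig_stop : forall n, stopping_time F (sig n).
Hypothesis tau_oo : {ae P, forall w, tau n w @[n --> \oo] --> +oo%E}.
Hypothesis sig_oo : {ae P, forall w, sig n w @[n --> \oo] --> +oo%E}.
Hypothesis tau_mart : forall n, martingale P F (fun t w => stopped (tau n) X t w - X 0 w).
Hypothesis sig_mart : forall n, martingale P F
  (fun t w => stopped (sig n) (fun t w => X t w ^+ 2 - QX w t) t w - (X 0 w ^+ 2 - QX w 0)).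
Context (T lam b : R).
Hypotheses (T0 : 0 < T) (lam0 : 0 < lam) (b2 : 1 / 2 < b).

Let Xe (u : R) w : R := X (Num.max u 0) w.

Let cXe w : continuous (Xe ^~ w).
Proof. exact: (@continuous_nonneg_ext _ (X ^~ w) (@cX w)). Qed.

Let XeE u w : 0 <= u -> Xe u w = X u w.
Proof. by move=> u0; rewrite /Xe max_l. Qed.

Let t_ n i : R := T * i%:R / n.+1%:R.

Let t_ge0 n i : 0 <= t_ n i.
Proof. by rewrite divr_ge0// mulr_ge0// ltW. Qed.

Let t_S n i : t_ n i.+1 = t_ n i + T / n.+1%:R.
Proof. by rewrite /t_ -natr1; ring. Qed.

Let t_le n i : t_ n i <= t_ n i.+1.
Proof. by rewrite t_S lerDl divr_ge0// ltW. Qed.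

Let t_leT n i : (i <= n.+1)%N -> t_ n i <= T.
Proof.
move=> iN; rewrite /t_ ler_pdivrMr// ler_wpM2l ?ler_nat//; exact: ltW.
Qed.

Let a_ n i : R := lam * (T - t_ n i).

Let a_ge0 n i : (i <= n.+1)%N -> 0 <= a_ n i.
Proof. by move=> iN; rewrite mulr_ge0 ?(ltW lam0)// subr_ge0 t_leT. Qed.

Let a_le n i : a_ n i <= lam * T.
Proof. by rewrite ler_wpM2l ?(ltW lam0)// gerBl. Qed.

Let lamT0 : 0 < lam * T. Proof. exact: mulr_gt0. Qed.

(** [osc] measures the increments up to time [u] over the [i]-th step of the grid
    and [G] is the largest of them: stopping when [G] reaches [k] keeps every grid
    increment within the range of [hexp]. Contrary to the modulus of the current
    increment, [G] is continuous in [u]. *)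
Let osc n i u w : R := Num.max
  (lam * T * `|Xe (Num.min u (t_ n i.+1)) w - Xe (Num.min u (t_ n i)) w|)
  ((lam * T) ^+ 2 * (QX w (Num.min u (t_ n i.+1)) - QX w (Num.min u (t_ n i)))).

Let G n u w : R := \big[Num.max/0]_(i < n.+1) osc n i u w.

Let continuous_min_cst (v : R) : continuous (fun u : R => Num.min u v).
Proof. by move=> u; apply: continuous_min; [exact: cvg_id|exact: cvg_cst]. Qed.

Let continuous_min_comp (f : R -> R) (v : R) : continuous f ->
  continuous (fun u : R => f (Num.min u v)).
Proof.
move=> cf u; apply: (@continuous_comp _ _ _ (fun u : R => Num.min u v) f).
  exact: continuous_min_cst.
exact: cf.
Qed.

Let cG n w : continuous (G n ^~ w).
Proof.
apply: (bigmax_continuous (Y := fun i u => osc n i u w)) => i.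
have hX v : continuous (fun u : R => Xe (Num.min u v) w).
  exact: (@continuous_min_comp (Xe ^~ w) v (@cXe w)).
have hQ v : continuous (fun u : R => QX w (Num.min u v)).
  exact: (@continuous_min_comp (QX w) v (@cQ w)).
apply: continuous_maxr => u.
- by apply: cvgMl_tmp; apply: cvg_norm; apply: cvgB; exact: hX.
- by apply: cvgMl_tmp; apply: cvgB; exact: hQ.
Qed.

Let aG n : adapted F (G n).
Proof.
move=> u u0; have su := filtration_sigma hF u0.
apply: (measurable_wrt_bigmax _ su (Y := fun i w => osc n i u w)) => i.
have m0 v : 0 <= v -> 0 <= Num.min u v <= u.
  by move=> v0; rewrite le_min u0 v0 ge_min lexx.
have cw (r : R) : measurable_wrt (F u) (fun _ : Omega => r) by exact: measurable_wrt_cst.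
have mX v : 0 <= v -> measurable_wrt (F u) (Xe (Num.min u v)).
  move=> /m0/andP[h1 h2]; rewrite (_ : Xe _ = X (Num.min u v)); last first.
    by apply/funext => w; rewrite XeE.
  exact: (adapted_wrt hF aX h1 h2).
have mQ v : 0 <= v -> measurable_wrt (F u) (fun w => QX w (Num.min u v)).
  move=> /m0/andP[h1 h2].
  exact: (adapted_wrt hF aQ h1 h2).
apply: measurable_wrt_max => //; apply: measurable_wrtM => //.
- apply: (measurable_wrt_comp su (h := fun x : R => `|x|)).
    exact: normr_measurable.
  by apply: measurable_wrtB => //; exact: mX.
- by apply: measurable_wrtB => //; exact: mQ.
Qed.

Section with_level.
Context (k c : R) (k0 : 0 < k).
Hypothesis hexp : forall x q : R, `|x| <= k -> 0 <= q -> q <= k ->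
    expR (x - b * q) <= 1 + x + c * (x ^+ 2 - q).

(** Besides bounding the increments, the stopping time must localize both [X] and
    [X ^+ 2 - QX]; the index of the grid serves as index of localization, so that
    one passage to the limit removes all three stoppings. *)
Let rho n w : \bar R :=
  mine (hitting_time (G n) k w) (mine (tau n w) (sig n w)).

Let rho_stop n : stopping_time F (rho n).
Proof.
apply: stopping_time_min => //; first exact: hitting_time_stopping.
exact: stopping_time_min.
Qed.

Let rho0 n w : (0 <= rho n w)%E. Proof. by case: (rho_stop n). Qed.

Let N n t w : R := stopped (rho n) X t w.
Let V n t w : R := QX w (cap t (rho n w)).

Let continuous_cap_path (f : R -> R) (x : \bar R) : (0 <= x)%E ->
  {within `[0, +oo[, continuous f} ->
  {within `[0, +oo[, continuous (fun t => f (cap t x))}.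
Proof.
move=> x0 cf.
apply: (@subspace_eq_continuous _ _ _ (fun t => f (Num.max (cap t x) 0))).
  by move=> t; rewrite inE/= in_itv/= andbT => tp; rewrite max_l// cap_ge0.
apply: continuous_subspaceT => t.
apply: (@continuous_comp _ _ _ (fun t => cap t x) (fun u => f (Num.max u 0))).
  exact: continuous_cap.
exact: continuous_nonneg_ext.
Qed.

(** Stopping [X] at [tau n] and then at the smaller [rho n] is stopping it at
    [rho n]. *)
Let hL n : martingale P F (fun t w => N n t w - X 0 w).
Proof.
have cM : continuous_paths (fun t w => stopped (tau n) X t w - X 0 w).
  move=> w t; apply: cvgB; last exact: cvg_cst.
  apply: (@continuous_cap_path (X ^~ w) (tau n w)); last exact: cX.
  by case: (tau_stop n).
have := martingale_stopped hF (tau_mart n) cM (rho_stop n).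
congr martingale; apply/funext => t; apply/funext => w.
rewrite /N /stopped -!/(cap _ _) cap_cap//.
by rewrite !ge_min lexx !orbT.
Qed.

Let hW n : martingale P F (fun t w => N n t w ^+ 2 - V n t w - X 0 w ^+ 2).
Proof.
have cM : continuous_paths (fun t w =>
    stopped (sig n) (fun t w => X t w ^+ 2 - QX w t) t w - (X 0 w ^+ 2 - QX w 0)).
  move=> w t; apply: cvgB; last exact: cvg_cst.
  apply: (@continuous_cap_path (fun t => X t w ^+ 2 - QX w t) (sig n w)).
    by case: (sig_stop n).
  move=> u; apply: cvgB; last exact: (continuous_subspaceT (@cQ w)).
  by apply: cvgM; exact: (@cX w).
have := martingale_stopped hF (sig_mart n) cM (rho_stop n).
congr martingale; apply/funext => t; apply/funext => w.
rewrite /N /V /stopped -!/(cap _ _) cap_cap//.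
  by rewrite (@Q0 w 0 (lexx 0)) subr0.
by rewrite !ge_min lexx !orbT.
Qed.

Let G_bound n w : G n (cap T (rho n w)) w <= k.
Proof.
apply: (@hitting_time_bound _ Omega R (G n) k (@cG n)).
- rewrite /G; apply: bigmax_le; first exact: ltW.
  move=> i _; rewrite /osc !min_l//; rewrite !subrr normr0 !mulr0 max_l//.
  exact: ltW.
- by rewrite cap_ge0// ltW.
- apply: le_trans (cap_fin_le T (rho0 n w)) _.
  by rewrite /rho ge_min lexx.
Qed.

Let osc_bound n i w : (i < n.+1)%N -> osc n i (cap T (rho n w)) w <= k.
Proof.
move=> iN; apply: le_trans (G_bound n w).
by rewrite /G (le_bigmax _ (fun j : 'I_n.+1 => osc n j (cap T (rho n w)) w) (Ordinal iN)).
Qed.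

Let cap_t n i w : (i <= n.+1)%N -> cap (t_ n i) (rho n w) = Num.min (cap T (rho n w)) (t_ n i).
Proof. by move=> iN; rewrite (cap_min (t_leT iN) (rho0 n w)) minC. Qed.

Let N_Xe n i w : (i <= n.+1)%N ->
  N n (t_ n i) w = Xe (Num.min (cap T (rho n w)) (t_ n i)) w.
Proof.
move=> iN; rewrite XeE; first by rewrite -cap_t.
by rewrite le_min t_ge0 cap_ge0// ltW.
Qed.

Let incN_bound n i w : (i < n.+1)%N ->
  lam * T * `|N n (t_ n i.+1) w - N n (t_ n i) w| <= k.
Proof.
move=> iN; have := osc_bound w iN; rewrite /osc ge_max => /andP[h _].
by rewrite !N_Xe// ltnW.
Qed.

Let incV_bound n i w : (i < n.+1)%N ->
  (lam * T) ^+ 2 * (V n (t_ n i.+1) w - V n (t_ n i) w) <= k.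
Proof.
move=> iN; have := osc_bound w iN; rewrite /osc ge_max => /andP[_ h].
by rewrite /V !cap_t// ltnW.
Qed.

Let incV_ge0 n i w : (i < n.+1)%N -> 0 <= V n (t_ n i.+1) w - V n (t_ n i) w.
Proof.
move=> iN; rewrite subr_ge0 /V !cap_t//; last exact: ltnW.
apply: cumulative_is_nondecreasing.
by rewrite le_min ge_min lexx /= ge_min t_le orbT.
Qed.

Let Z n w : R := exp_process (N n) (V n) (X 0) (t_ n) (a_ n) b n.+1 w.

Let b0 : 0 <= b. Proof. by rewrite ltW// (lt_trans _ b2). Qed.

Let N_0 n w : N n 0 w = X 0 w.
Proof.
rewrite /N /stopped -/(cap 0 (rho n w)); congr (X _ w).
by apply/eqP; rewrite eq_le cap_le// cap_ge0.
Qed.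

Let incNk n i w : (i < n.+1)%N -> `|a_ n i * (N n (t_ n i.+1) w - N n (t_ n i) w)| <= k.
Proof.
move=> iN; apply: le_trans (incN_bound w iN).
by rewrite normrM ler_wpM2r// ger0_norm ?a_le// a_ge0// ltnW.
Qed.

Let incVk n i w : (i < n.+1)%N -> a_ n i ^+ 2 * (V n (t_ n i.+1) w - V n (t_ n i) w) <= k.
Proof.
move=> iN; apply: le_trans (incV_bound w iN).
rewrite ler_wpM2r// ?incV_ge0// ler_sqr ?nnegrE ?a_le ?(ltW lamT0)// a_ge0//.
exact: ltnW.
Qed.

Let incN_eta n i w : (i < n.+1)%N ->
  `|N n (t_ n i.+1) w - N n (t_ n i) w| <= k / (lam * T).
Proof. by move=> iN; rewrite ler_pdivlMr// mulrC; exact: incN_bound. Qed.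

Let Z_le1 n : E (Z n) <= 1.
Proof.
have x0 : measurable_wrt (F 0) (X 0) by exact: aX.
apply: (exp_process_le1 hF x0 (hL n) (hW n) (n := n.+1) (c := c) (eta := k / (lam * T))
  _ (@t_le n) (@N_0 n) b0 _ hexp (@incN_eta n) (@incNk n) (@incV_ge0 n) (@incVk n)).
- by rewrite /t_ mulr0 mul0r.
- by rewrite divr_ge0// ltW.
Qed.


Let J w : R := (\int[lebesgue_measure]_(u in `[0, T]) X u w)%R.
Let A w : R :=
  (\int[lebesgue_stieltjes_measure (QX w)]_(u in `]0, T]) (T - u) ^+ 2)%R.

(** By uniform continuity, all increments over a fine grid are below the
    threshold. *)
Let hitting_oo w : \forall n \near \oo, hitting_time (G n) k w = +oo%E.
Proof.
have kX : 0 < k / (lam * T) by rewrite divr_gt0.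
have kQ : 0 < k / (lam * T) ^+ 2 by rewrite divr_gt0// exprn_gt0.
have [e1 e10 H1] := @uniform_continuity_segment _ (Xe ^~ w) 0 T _ (@cXe w) kX.
have [e2 e20 H2] := @uniform_continuity_segment _ (QX w) 0 T _ (@cQ w) kQ.
have e0 : 0 < Num.min e1 e2 / T by rewrite divr_gt0// lt_min e10.
have := near_infty_natSinv_lt (PosNum e0); apply: filterS => n /= hn.
have {}hn : T / n.+1%:R < Num.min e1 e2 by rewrite mulrC -ltr_pdivlMr.
apply: hitting_time_pinfty => u u0.
rewrite /G; apply: bigmax_lt => // i _.
have h1 : 0 <= Num.min u (t_ n i) <= T.
  by rewrite le_min u0 t_ge0 ge_min t_leT ?orbT// ltnW.
have h2 : `|Num.min u (t_ n i.+1) - Num.min u (t_ n i)| < Num.min e1 e2.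
  apply: le_lt_trans hn; rewrite ger0_norm.
    rewrite lerBlDl; have [ut|tu] := leP u (t_ n i).
      by rewrite ge_min lerDl divr_ge0// ltW.
    by rewrite -t_S ge_min lexx orbT.
  by rewrite subr_ge0 le_min ge_min lexx/= ge_min t_le orbT.
move: h2; rewrite lt_min => /andP[h2 h3].
rewrite /osc gt_max; apply/andP; split.
- by rewrite mulrC -ltr_pdivlMr//; exact: H1.
- rewrite mulrC -ltr_pdivlMr ?exprn_gt0//.
  by apply: le_lt_trans (ler_norm _) _; exact: H2.
Qed.

(** From some index on, [rho n] exceeds [T] and the exponent is a combination of
    grid sums of the unstopped processes. *)
Let Z_cvg : {ae P, forall w, Z n w @[n --> \oo] -->
  expR (lam * J w - b * (lam ^+ 2 * A w))}.
Proof.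
move: hX0 tau_oo sig_oo; apply: filterS3 => w X0w ht hs.
have S1 := @grid_abel_cvg _ (X ^~ w) T (@cX w) T0.
have S2 := @grid_square_weight_cvg _ (QX w) T T0.
rewrite X0w mulr0 subr0 -/(J w) in S1; rewrite -/(A w) in S2.
pose S n := lam * (\sum_(i < n.+1) (T - T * i%:R / n.+1%:R) *
     (X (T * i.+1%:R / n.+1%:R) w - X (T * i%:R / n.+1%:R) w)) -
   b * (lam ^+ 2 * (\sum_(i < n.+1) (T - T * i%:R / n.+1%:R) ^+ 2 *
     (QX w (T * i.+1%:R / n.+1%:R) - QX w (T * i%:R / n.+1%:R)))).
have cS : expR (S n) @[n --> \oo] --> expR (lam * J w - b * (lam ^+ 2 * A w)).
  apply: cvg_continuous_comp; first exact: continuous_expR.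
  apply: cvgB; first by apply: cvgMl_tmp; exact: S1.
  by apply: cvgMl_tmp; apply: cvgMl_tmp; exact: S2.
apply: cvg_trans cS; apply: near_eq_cvg.
near=> n.
have rT : cap T (rho n w) = T.
  apply: cap_id; rewrite /rho !le_min; apply/and3P; split.
  - have -> : hitting_time (G n) k w = +oo%E by near: n; exact: hitting_oo.
    exact: leey.
  - by near: n; move/cvgeyPge : ht; apply.
  - by near: n; move/cvgeyPge : hs; apply.
rewrite /Z /exp_process indicE mem_set//= mul1r; congr expR.
rewrite /S !mulr_sumr -sumrB; apply: eq_bigr => i _.
have iN := ltn_ord i.
have NX j : (j <= n.+1)%N -> N n (t_ n j) w = X (t_ n j) w.
  by move=> jn; rewrite N_Xe// rT min_r ?t_leT// XeE.
have VQ j : (j <= n.+1)%N -> V n (t_ n j) w = QX w (t_ n j).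
  by move=> jn; rewrite /V cap_t// rT min_r ?t_leT.
rewrite !NX ?(ltnW iN)// !VQ ?(ltnW iN)// /a_ -!/(t_ n _).
by ring.
Unshelve. all: by end_near. Qed.

Lemma exponential_bound_level :
  (\int[P]_w (expR (lam * J w - b * (lam ^+ 2 * A w)))%:E <= 1)%E.
Proof.
have mZ n : integ P (Z n).
  have x0 : measurable_wrt (F 0) (X 0) by exact: aX.
  apply: (integ_exp_process hF x0 (hL n) (hW n) (n := n.+1) _ (@t_le n) b0
    (@incNk n) (@incV_ge0 n)) => //.
  by rewrite /t_ mulr0 mul0r.
apply: (@fatou_le _ _ _ P Z) => //.
- by move=> n; exact: (integ_measurable (mZ n)).
- apply: measurableT_comp; first exact: measurable_expR.
  apply: measurable_funB.
    apply: measurable_funM => //.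
    exact: (measurable_integral_path hF aX cX (ltW T0)).
  apply: measurable_funM => //; apply: measurable_funM => //.
  exact: (measurable_stieltjes_square_weight hF aQ T0).
- by move=> n w; rewrite /Z /exp_process mulr_ge0 ?expR_ge0// indicE.
Qed.

End with_level.

Lemma exponential_bound :
  (\int[P]_w (expR (lam * (\int[lebesgue_measure]_(u in `[0, T]) X u w)%R -
     b * (lam ^+ 2 *
      (\int[lebesgue_stieltjes_measure (QX w)]_(u in `]0, T]) (T - u) ^+ 2)%R)))%:E <= 1)%E.
Proof.
have [k [c [k0 _ h]]] := expR_compensated b2.
exact: exponential_bound_level k0 h.
Qed.

End exponential_bound.

(** * The tail bound *)

(** Markov's inequality with [lam = r / s], the minimizer of
    [- lam * r + lam ^+ 2 * s / 2], followed by [b --> 1 / 2]. *)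
Lemma chernoff (d : measure_display) (Omega : measurableType d) (R : realType)
  (P : probability Omega R) (J A : Omega -> R) (r s : R) :
  measurable_fun setT J -> measurable_fun setT A -> 0 < r -> 0 < s ->
  (forall lam b : R, 0 < lam -> 1 / 2 < b ->
    (\int[P]_w (expR (lam * J w - b * (lam ^+ 2 * A w)))%:E <= 1)%E) ->
  (P [set w | (r <= J w)%R /\ (A w <= s)%R] <= (expR (- (r ^+ 2 / (2 * s))))%:E)%E.
Proof.
move=> mJ mA r0 s0 H; set Ev := [set w | _].
have mEv : measurable Ev.
  rewrite (_ : Ev = (J @^-1` `[r, +oo[) `&` (A @^-1` `]-oo, s])).
    apply: measurableI; rewrite -[X in measurable X]setTI.
      by apply: mJ => //; exact: measurable_itv.
    by apply: mA => //; exact: measurable_itv.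
  by apply/seteqP; split=> w /=; rewrite !in_itv/= andbT.
have bound n : (P Ev <= (expR (- (r ^+ 2 / s) + (1 / 2 + n.+1%:R^-1) * (r ^+ 2 / s)))%:E)%E.
  set b := 1 / 2 + n.+1%:R^-1.
  have b2 : 1 / 2 < b by rewrite ltrDl invr_gt0.
  pose lam := r / s; have lam0 : 0 < lam by rewrite divr_gt0.
  pose y := - (r ^+ 2 / s) + b * (r ^+ 2 / s).
  have yE : y = - (lam * r - b * (lam ^+ 2 * s)).
    by rewrite /y /lam; field; rewrite gt_eqF.
  have : ((expR (- y))%:E * P Ev <= 1)%E.
    apply: le_trans (H lam b lam0 b2).
    have -> : ((expR (- y))%:E * P Ev = \int[P]_w ((expR (- y))%:E * (\1_Ev w)%:E))%E.
      have iE : P.-integrable setT (fun w => (\1_Ev w : R)%:E).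
        apply: (@integ_bounded _ _ _ _ _ 1) => // w.
        by rewrite indicE; case: (_ \in _); rewrite ?normr1 ?normr0.
      by rewrite (integralZl measurableT iE) integral_indic// setIT.
    apply: ge0_le_integral => //.
    - by apply/measurable_EFinP; apply: measurable_funM => //; exact: measurable_indic.
    - apply/measurable_EFinP; apply: measurableT_comp; first exact: measurable_expR.
      by apply: measurable_funB; do !apply: measurable_funM => //.
    - move=> w _; rewrite -EFinM lee_fin indicE.
      have [/set_mem[/= rJ As]|_] := boolP (w \in Ev); last by rewrite mulr0 expR_ge0.
      rewrite mulr1 ler_expR yE opprK lerB//; first by rewrite ler_wpM2l// ltW.
      have b0 : 0 <= b by rewrite ltW// (lt_trans _ b2).
      by rewrite ler_wpM2l// ler_wpM2l// sqr_ge0.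
  have : (0 < expR (- y)) by exact: expR_gt0.
  rewrite -/y.
  have PF : P Ev \is a fin_num by exact: fin_num_measure.
  rewrite -(fineK PF) -EFinM !lee_fin => e0.
  by rewrite expRN mulrC ler_pdivrMr ?expR_gt0// mul1r.
have PF : P Ev \is a fin_num by exact: fin_num_measure.
rewrite -(fineK PF) lee_fin.
have cv : expR (- (r ^+ 2 / s) + (1 / 2 + n.+1%:R^-1) * (r ^+ 2 / s)) @[n --> \oo] -->
    expR (- (r ^+ 2 / s) + (1 / 2 + 0) * (r ^+ 2 / s)).
  apply: cvg_continuous_comp; first exact: continuous_expR.
  apply: cvgD; first exact: cvg_cst.
  apply: cvgMr_tmp; apply: cvgD; first exact: cvg_cst.
  exact: cvg_harmonic.
have -> : - (r ^+ 2 / (2 * s)) = - (r ^+ 2 / s) + (1 / 2 + 0) * (r ^+ 2 / s).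
  by field; rewrite gt_eqF.
rewrite -(cvg_lim _ cv)//; apply: limr_ge; first by apply/cvg_ex; eexists; exact: cv.
apply: nearW => n; rewrite -lee_fin (fineK PF); exact: bound.
Qed.

Theorem integral_tail_bound (d : measure_display) (Omega : measurableType d)
  (R : realType) (P : probability Omega R) (F : R -> set (set Omega))
  (X : R -> Omega -> R) (QX : Omega -> cumulative R R) (T r s : R) :
  is_filtration F -> continuous_local_martingale P F X ->
  {ae P, forall w, X 0 w = 0} -> quadratic_variation P F X QX ->
  0 < T -> 0 < r -> 0 < s ->
  (P [set w | (r <= \int[lebesgue_measure]_(u in `[0, T]) X u w)%R /\
              \int[lebesgue_stieltjes_measure (QX w)]_(u in `[0%R, T])
                ((T - u) ^+ 2)%:E <= s%:E]
   <= (expR (- (r ^+ 2 / (2 * s))))%:E)%E.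
Proof.
move=> hF [aX cX [tau [tau_stop _ tau_oo tau_mart]]] hX0
  [Q0 cQ [aQ [_ _ [sig [sig_stop _ sig_oo sig_mart]]]]] T0 r0 s0.
have -> : [set w | (r <= \int[lebesgue_measure]_(u in `[0, T]) X u w)%R /\
   (\int[lebesgue_stieltjes_measure (QX w)]_(u in `[0%R, T])
                ((T - u) ^+ 2)%:E <= s%:E)%E] =
   [set w | r <= (\int[lebesgue_measure]_(u in `[0, T]) X u w)%R /\
    (\int[lebesgue_stieltjes_measure (QX w)]_(u in `]0, T]) (T - u) ^+ 2)%R <= s].
  by apply/funext => w; rewrite /= (stieltjes_square_weight (@cQ w) T0) lee_fin.
apply: chernoff => //.
- exact: (measurable_integral_path hF aX cX (ltW T0)).
- exact: (measurable_stieltjes_square_weight hF aQ T0).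
- move=> lam b lam0 b2.
  exact: (exponential_bound hF aX cX hX0 Q0 cQ aQ tau_stop sig_stop tau_oo sig_oo
    tau_mart sig_mart T0 lam0 b2).
Qed.

(** * Convergence in probability *)

Section convergence_in_probability.
Context (d : measure_display) (Omega : measurableType d) (R : realType).
Context (P : probability Omega R).

Lemma measurable_norm_ge (Z : Omega -> R) (e : R) : measurable_fun setT Z ->
  measurable [set w | e <= `|Z w|].
Proof.
move=> mZ; rewrite (_ : [set w | _] = (fun w => `|Z w|) @^-1` `[e, +oo[).
  rewrite -[X in measurable X]setTI.
  have mN : measurable_fun setT (fun w => `|Z w|).
    by apply: measurableT_comp mZ; exact: normr_measurable.
  by apply: mN => //; exact: measurable_itv.
by apply/seteqP; split=> w /=; rewrite in_itv/= andbT.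
Qed.

Lemma cvg_pointwise_in_probability (Z : nat -> Omega -> R) (e : R) :
  (forall n, measurable_fun setT (Z n)) -> 0 < e ->
  (forall w, Z n w @[n --> \oo] --> (0 : R)) ->
  P [set w | e <= `|Z n w|] @[n --> \oo] --> 0%E.
Proof.
move=> mZ e0 Z0; pose A n := [set w | e <= `|Z n w|].
have mA n : measurable (A n) by exact: measurable_norm_ge.
have [| | | |_] := @EP_cvg _ _ _ P (fun n => \1_(A n)) (fun=> 0) (fun=> 1).
- by move=> n; exact: measurable_indic.
- move=> w; have := Z0 w => /cvgrPdist_lt/(_ _ e0) H.
  apply: cvg_near_cst; apply: filterS H => n.
  by rewrite sub0r normrN indicE => h; rewrite memNset//= /A/= leNgt h.
- exact: integ_cst.
- by move=> n w; rewrite indicE; case: (_ \in _); rewrite ?normr1 ?normr0.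
- rewrite EP_cst => H; apply/fine_cvgP; split.
    by apply: nearW => n; apply: fin_num_measure; exact: mA.
  apply: cvg_trans H; apply: near_eq_cvg; apply: nearW => n /=.
  by rewrite /EP /Rintegral integral_indic// setIT.
Qed.

Lemma cvg_in_probability_ae_eq (Z : nat -> Omega -> R) (I J : Omega -> R) :
  (forall n, measurable_fun setT (Z n)) -> measurable_fun setT I ->
  measurable_fun setT J ->
  cvg_to0_in_probability P (fun n w => `|Z n w - I w|%:E) ->
  (forall w, Z n w @[n --> \oo] --> J w) ->
  {ae P, forall w, J w = I w}.
Proof.
move=> mZ mI mJ ZI ZJ.
have null (e : R) : 0 < e -> P [set w | e + e <= `|J w - I w|] = 0%E.
  move=> e0; apply/eqP; rewrite eq_le measure_ge0 andbT.
  have c1 := ZI _ e0.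
  have c2 : P [set w | e <= `|Z n w - J w|] @[n --> \oo] --> 0%E.
    apply: (@cvg_pointwise_in_probability (fun n w => Z n w - J w)) => //.
      by move=> n; exact: measurable_funB.
    by move=> w; rewrite -(subrr (J w)); apply: cvgB; [exact: ZJ|exact: cvg_cst].
  have c3 : (P [set w | (e%:E <= `|Z n w - I w|%:E)%E] +
      P [set w | (e <= `|Z n w - J w|)%R])%E @[n --> \oo] --> 0%E.
    by rewrite -(adde0 0%E); apply: cvgeD.
  rewrite -(cvg_lim _ c3)//; apply: lime_ge; first by apply/cvg_ex; eexists; exact: c3.
  apply: nearW => n.
  have m1 : measurable [set w | (e%:E <= `|Z n w - I w|%:E)%E].
    rewrite (_ : [set w | _] = [set w | e <= `|Z n w - I w|]).
      by apply: (@measurable_norm_ge (fun w => Z n w - I w)); exact: measurable_funB.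
    by apply/seteqP; split=> w /=; rewrite lee_fin.
  have m2 : measurable [set w | e <= `|Z n w - J w|].
    by apply: (@measurable_norm_ge (fun w => Z n w - J w)); exact: measurable_funB.
  apply: le_trans (measureU2 _ m1 m2); apply: le_measure; rewrite ?inE.
  - by apply: (@measurable_norm_ge (fun w => J w - I w)); exact: measurable_funB.
  - exact: measurableU.
  - move=> w /= h; rewrite lee_fin.
    have [h1|h1] := leP e `|Z n w - I w|; first by left.
    right; rewrite leNgt; apply/negP => h2; move: h; rewrite leNgt => /negP; apply.
    have -> : J w - I w = (Z n w - I w) - (Z n w - J w) by ring.
    by rewrite (le_lt_trans (ler_normB _ _))// ltrD.
have : {ae P, forall w, forall m : nat, `|J w - I w| < m.+1%:R^-1 + m.+1%:R^-1}.
  apply: ae_foralln => m.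
  exists [set w | m.+1%:R^-1 + m.+1%:R^-1 <= `|J w - I w|]; split => //.
  - by apply: (@measurable_norm_ge (fun w => J w - I w)); exact: measurable_funB.
  - by apply: null; rewrite invr_gt0.
  - by move=> w /= /negP; rewrite -leNgt.
apply: filterS => w H; apply/eqP; rewrite -subr_eq0 -normr_eq0.
rewrite eq_le normr_ge0 andbT; apply/ler_addgt0Pr => e e0; rewrite add0r.
have e2 : 0 < e / 2 by rewrite divr_gt0.
have [m _ /(_ m (leqnn m)) /= me] := near_infty_natSinv_lt (PosNum e2).
by apply/ltW/(lt_trans (H m)); rewrite [ltRHS]splitr ltrD.
Qed.

End convergence_in_probability.

(** * The stochastic integral of a linear function *)

Section integration_by_parts.
Context (d : measure_display) (Omega : measurableType d) (R : realType).
Context (P : probability Omega R) (F : R -> set (set Omega)).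
Hypothesis hF : is_filtration F.
Context (X : R -> Omega -> R) (QX : Omega -> cumulative R R).
Hypotheses (aX : adapted F X) (cX : continuous_paths X).
Hypothesis Q0 : forall w t, t <= 0 -> QX w t = 0.
Hypothesis cQ : forall w, continuous (QX w).
Hypothesis aQ : adapted F (fun t w => QX w t).
Context (T : R).

Let time n i : R := i%:R / n.+1%:R.

(** The step is [1 / (n + 1)] and there are [(n + 1) ^ 2] steps, so that the
    partition covers [`]0, n + 1]]: an approximation is required on every bounded
    interval and not only up to [T]. *)
Definition left_point_process n : simple_process Omega R :=
  SimpleProcess (n.+1 * n.+1) (time n) (fun i _ => T - time n i).

Let time_ge0 n i : 0 <= time n i. Proof. by rewrite divr_ge0. Qed.

Let timeS n i : time n i.+1 = time n i + n.+1%:R^-1.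
Proof. by rewrite /time -natr1 mulrDl mul1r. Qed.

Let time_lt n i : time n i < time n i.+1.
Proof. by rewrite timeS ltrDl invr_gt0. Qed.

Let time_mono n i j : (i <= j)%N -> time n i <= time n j.
Proof. by move=> ij; rewrite ler_wpM2r ?invr_ge0// ler_nat. Qed.

Let time_size n : time n (n.+1 * n.+1) = n.+1%:R.
Proof. by rewrite /time natrM mulfK// pnatr_eq0. Qed.

Lemma left_point_predictable n : simple_predictable F (left_point_process n).
Proof.
split => /=.
- exact: time_ge0.
- by move=> i _; exact: time_lt.
- move=> i _; apply: measurable_wrt_cst.
  by apply: filtration_sigma.
- exists (`|T| + n.+1%:R) => i w iN.
  rewrite (le_trans (ler_normB _ _))// lerD2l ger0_norm//.
  by rewrite -time_size time_mono// ltnW.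
Qed.

Lemma left_point_value n i u w : (i < n.+1 * n.+1)%N ->
  time n i < u <= time n i.+1 ->
  simple_value (left_point_process n) u w = T - time n i.
Proof.
move=> iN ui; rewrite /simple_value/= (bigD1 (Ordinal iN))//= ui mulr1.
rewrite big1 ?addr0// => j /negP ji; move: ui => /andP[h1 h2].
have [/andP[h3 h4]|_] := boolP (time n j < u <= time n j.+1); last by rewrite mulr0.
exfalso; apply: ji; apply/eqP/val_inj => /=; apply/eqP; rewrite eqn_leq.
apply/andP; split; rewrite leqNgt; apply/negP => /(time_mono n).
- by move=> /(le_trans h2)/(lt_le_trans h3); rewrite ltxx.
- by move=> /(le_trans h4)/(lt_le_trans h1); rewrite ltxx.
Qed.

Let gap n u w : R := (simple_value (left_point_process n) u w - (T - u)) ^+ 2.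

Let gap_on n i u w : (i < n.+1 * n.+1)%N -> time n i < u <= time n i.+1 ->
  gap n u w = (u - time n i) ^+ 2.
Proof. by move=> iN ui; rewrite /gap (left_point_value w iN ui); ring. Qed.

Let measurable_gap n w : measurable_fun setT (fun u : R => gap n u w).
Proof.
have mv : measurable_fun setT (fun u : R => simple_value (left_point_process n) u w).
  apply: measurable_sum => i; apply: measurable_funM => //.
  rewrite (_ : (fun u => _) = \1_`]time n i, time n i.+1]).
    by apply: measurable_indic; exact: measurable_itv.
  apply/funext => u; rewrite indicE /=; congr (_%:R).
  by congr nat_of_bool; apply/idP/idP; rewrite inE/= in_itv.
apply: measurable_funX; apply: measurable_funB => //.
by apply: measurable_funB.
Qed.

Section at_time.
Context (t : R) (t0 : 0 <= t).

Let s n i : R := Num.min (time n i) t.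

Let s_ge0 n i : 0 <= s n i. Proof. by rewrite le_min time_ge0. Qed.

Let s_le n i : s n i <= s n i.+1.
Proof. by rewrite le_min ge_min (ltW (time_lt _ _))/= ge_min lexx orbT. Qed.

Let s_0 n : s n 0 = 0.
Proof. by rewrite /s /time mul0r min_l. Qed.

Let s_N n : t <= n.+1%:R -> s n (n.+1 * n.+1) = t.
Proof. by move=> tn; rewrite /s time_size min_r. Qed.

Let s_mesh n i : s n i.+1 - s n i <= 1 / n.+1%:R.
Proof.
rewrite lerBlDl div1r /s; have [h|h] := leP (time n i) t.
  by rewrite -timeS ge_min lexx.
by rewrite ge_min lerDl invr_ge0 ler0n orbT.
Qed.

Let s_sub n i u : s n i < u <= s n i.+1 -> time n i < u <= time n i.+1.
Proof.
rewrite le_min => /andP[h1 /andP[-> h3]]; rewrite andbT.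
by move: h1; rewrite /s gt_min [t < u]ltNge h3 orbF.
Qed.

Let eventually_covered : \forall n \near \oo, t <= n.+1%:R.
Proof.
apply: filterS (nbhs_infty_ger t) => n tn.
by rewrite (le_trans tn)// ler_nat.
Qed.

Let gap_integrable n w :
  (lebesgue_stieltjes_measure (QX w)).-integrable `]0, t] (EFin \o (fun u => gap n u w)).
Proof.
pose B := \sum_(i < n.+1 * n.+1) `|T - time n i|.
apply: (@integrable_itvoc_bounded _ _ _ _ _ ((B + (`|T| + t)) ^+ 2)).
  exact: measurable_funTS.
move=> u /andP[u0 ut]; rewrite ger0_norm ?sqr_ge0// /gap -real_normK ?num_real//.
rewrite lerXn2r ?nnegrE ?addr_ge0 ?sumr_ge0//.
rewrite (le_trans (ler_normB _ _))// lerD//.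
- rewrite /simple_value (le_trans (ler_norm_sum _ _ _))// ler_sum// => i _.
  rewrite normrM -[leRHS]mulr1 ler_wpM2l//.
  by case: (_ < _ <= _); rewrite ?normr1 ?normr0.
- rewrite (le_trans (ler_normB _ _))// lerD2l ger0_norm//; exact: ltW.
Qed.

Let dist n w : R := (\int[lebesgue_stieltjes_measure (QX w)]_(u in `]0, t]) gap n u w)%R.

(** The integrand is continuous on each step only, hence the splitting, which is
    what makes [dist] measurable. *)
Let dist_sum n w : t <= n.+1%:R -> dist n w = \sum_(i < n.+1 * n.+1)
  (\int[lebesgue_stieltjes_measure (QX w)]_(u in `]s n i, s n i.+1]) (u - time n i) ^+ 2)%R.
Proof.
move=> tn; have := @Rintegral_itvoc_sum _ (QX w) (fun u => gap n u w) (s n) (n.+1 * n.+1)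
  (fun i _ => s_le n i).
rewrite s_0 s_N// => /(_ (gap_integrable n w)) e; rewrite /dist e.
apply: eq_bigr => i _; apply: eq_Rintegral => u; rewrite inE/= in_itv/= => /s_sub.
exact: gap_on.
Qed.

Let continuous_sqr_shift (a : R) : continuous (fun u : R => (u - a) ^+ 2).
Proof. by move=> u; apply: cvgM; (apply: cvgB; [exact: cvg_id|exact: cvg_cst]). Qed.

Let measurable_dist n : t <= n.+1%:R -> measurable_fun setT (dist n).
Proof.
move=> tn; rewrite (_ : dist n = fun w => \sum_(i < n.+1 * n.+1)
  (\int[lebesgue_stieltjes_measure (QX w)]_(u in `]s n i, s n i.+1]) (u - time n i) ^+ 2)%R).
  apply: measurable_sum => i.
  exact: (measurable_stieltjes_continuous hF aQ (@continuous_sqr_shift _) (s_ge0 _ _) (s_le _ _)).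
by apply/funext => w; exact: dist_sum.
Qed.

Let dist_bound n w : t <= n.+1%:R -> `|dist n w| <= (n.+1%:R^-1) ^+ 2 * (QX w t).
Proof.
move=> tn; have := @stieltjes_riemann_bound _ (QX w) (fun u => gap n u w) (s n)
  (fun=> 0) (n.+1 * n.+1) (n.+1%:R^-1 ^+ 2) (fun i _ => s_le n i).
rewrite s_0 s_N// => /(_ (gap_integrable n w)).
rewrite big1; last by move=> i _; rewrite mul0r.
rewrite subr0 (@Q0 w 0 (lexx 0)) subr0; apply.
move=> i u iN /s_sub ui; rewrite subr0 (gap_on w iN ui).
move: ui; rewrite timeS => /andP[h1 h2].
rewrite ger0_norm ?sqr_ge0// lerXn2r// ?nnegrE ?subr_ge0 ?(ltW h1)//.
by rewrite lerBlDl.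
Qed.

Let dist_cvg w : dist n w @[n --> \oo] --> (0 : R).
Proof.
apply/cvgrPdist_lt => e e0.
have Q_ge0 : 0 <= QX w t.
  by rewrite -(@Q0 w 0 (lexx 0)); exact: cumulative_is_nondecreasing.
have e1 : 0 < e / (QX w t + 1) by rewrite divr_gt0// ltr_wpDl.
have := near_infty_natSinv_lt (PosNum e1); near_simpl => /= H.
near=> n; rewrite sub0r normrN.
have tn : t <= n.+1%:R by near: n; exact: eventually_covered.
apply: le_lt_trans (dist_bound w tn) _.
have hn : n.+1%:R^-1 < e / (QX w t + 1) by near: n.
apply: (@le_lt_trans _ _ (n.+1%:R^-1 * (QX w t + 1))).
  rewrite ler_pM// ?sqr_ge0 ?lerDl//.
  by rewrite expr2 -[leRHS]mulr1 ler_wpM2l ?invr_ge0// invf_le1// ler1n.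
by rewrite -ltr_pdivlMr// ltr_wpDl.
Unshelve. all: by end_near. Qed.

Lemma left_point_approximation_at : cvg_to0_in_probability P (fun n w =>
  (\int[lebesgue_stieltjes_measure (QX w)]_(u in `[0%R, t])
    ((simple_value (left_point_process n) u w - (T - u)) ^+ 2)%:E)%E).
Proof.
move=> e e0.
pose Z n w : R := if t <= n.+1%:R then dist n w else 0.
have cZ : P [set w | e <= `|Z n w|] @[n --> \oo] --> 0%E.
  apply: cvg_pointwise_in_probability => //.
    move=> n; have [tn|tn] := boolP (t <= n.+1%:R).
      rewrite (_ : Z n = dist n); first exact: measurable_dist.
      by rewrite /Z tn.
    by rewrite (_ : Z n = fun=> 0)// /Z (negbTE tn).
  move=> w; apply: cvg_trans (dist_cvg w); apply: near_eq_cvg.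
  by apply: filterS eventually_covered => n tn; rewrite /Z tn.
apply: cvg_trans cZ; apply: near_eq_cvg.
apply: filterS eventually_covered => n tn.
congr (P _); apply/funext => w; rewrite /= /Z tn.
have -> : (\int[lebesgue_stieltjes_measure (QX w)]_(u in `[0%R, t])
    ((simple_value (left_point_process n) u w - (T - u)) ^+ 2)%:E = (dist n w)%:E)%E.
  rewrite (@integral_itvcc_itvoc _ (QX w) 0 t (fun u => gap n u w)) //; last first.
  - by move=> u; exact: sqr_ge0.
  - exact: measurable_funTS.
  - exact: cQ.
  rewrite fineK//; apply: integrable_fin_num; first exact: measurable_itv.
  exact: gap_integrable.
rewrite lee_fin ger0_norm//.
by apply: Rintegral_ge0 => u _; exact: sqr_ge0.
Qed.

(** The convergence holds on every path; after time [t] the increments vanish, so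
    that the coefficient at the uncut time may be replaced by the one at the cut
    time before Abel summation. *)
Lemma left_point_integral_cvg w :
  simple_integral (left_point_process n) X t w @[n --> \oo] -->
  (\int[lebesgue_measure]_(u in `[0, t]) X u w)%R + (T - t) * X t w - T * X 0 w.
Proof.
have E n : t <= n.+1%:R -> simple_integral (left_point_process n) X t w =
    \sum_(i < n.+1 * n.+1) X (Num.max (s n i.+1) 0) w * (s n i.+1 - s n i) +
    (T - t) * X t w - T * X 0 w.
  move=> tn; rewrite /simple_integral/=.
  transitivity (\sum_(i < n.+1 * n.+1) (T - s n i) * (X (s n i.+1) w - X (s n i) w)).
    apply: eq_bigr => i _; rewrite -!/(s n _).
    have [h|h] := leP (time n i) t; first by rewrite /s (min_l h).
    by rewrite /s !min_r ?subrr ?mulr0// ltW// (lt_trans h).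
  rewrite (abel_summation T (s n) (fun i => X (s n i) w)) s_N// s_0 subr0.
  rewrite addrC addrA; congr (_ + _ - _); apply: eq_bigr => i _.
  by rewrite max_l.
have c1 : \sum_(i < n.+1 * n.+1) X (Num.max (s n i.+1) 0) w * (s n i.+1 - s n i)
    @[n --> \oo] --> (\int[lebesgue_measure]_(u in `[0, t]) X u w)%R.
  apply: (@lebesgue_riemann_cvg _ (X ^~ w) t 1 (fun n => (n.+1 * n.+1)%N) s) => //.
  apply: filterS eventually_covered => n tn.
  by split; [exact: s_0|exact: s_N|move=> i _; split].
have c2 : \sum_(i < n.+1 * n.+1) X (Num.max (s n i.+1) 0) w * (s n i.+1 - s n i) +
    (T - t) * X t w - T * X 0 w @[n --> \oo] -->
  (\int[lebesgue_measure]_(u in `[0, t]) X u w)%R + (T - t) * X t w - T * X 0 w.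
  by apply: cvgB; [apply: cvgD; [exact: c1|exact: cvg_cst]|exact: cvg_cst].
apply: cvg_trans c2; apply: near_eq_cvg.
by apply: filterS eventually_covered => n tn; rewrite E.
Qed.

Let measurable_simple_integral n :
  measurable_fun setT (simple_integral (left_point_process n) X t).
Proof.
have mX v : 0 <= v -> measurable_fun setT (X v) := adapted_measurable hF aX.
apply: measurable_sum => i; apply: measurable_funM.
  exact: measurable_cst.
by apply: measurable_funB; [exact: (mX _ (s_ge0 n i.+1))|exact: (mX _ (s_ge0 n i))].
Qed.

Context (I : R -> Omega -> R).
Hypothesis hI : stochastic_integral P F X QX (fun u _ => T - u) I.
Hypothesis hX0 : {ae P, forall w, X 0 w = 0}.
Hypothesis happrox : simple_approximation P F QX (fun u _ => T - u) left_point_process.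

(** The elementary integrals converge in probability to [I t] by definition and
    on each path to the integrated form. *)
Lemma stochastic_integral_at : {ae P, forall w,
  (\int[lebesgue_measure]_(u in `[0, t]) X u w)%R = I t w - (T - t) * X t w}.
Proof.
have [aI cI _ /(_ _ happrox _ t0) hcv] := hI.
have mX v : 0 <= v -> measurable_fun setT (X v) := adapted_measurable hF aX.
have mJ : measurable_fun setT (fun w =>
    (\int[lebesgue_measure]_(u in `[0, t]) X u w)%R + (T - t) * X t w - T * X 0 w).
  apply: measurable_funB.
    apply: measurable_funD; first exact: (measurable_integral_path hF aX cX t0).
    by apply: measurable_funM => //; exact: mX.
  by apply: measurable_funM => //; exact: mX.
have := cvg_in_probability_ae_eq measurable_simple_integral
  (adapted_measurable hF aI t0) mJ hcv left_point_integral_cvg.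
move: hX0; apply: filterS2 => w Xw <-.
by rewrite Xw; ring.
Qed.

End at_time.
End integration_by_parts.

(** * The theorem *)

Lemma eq_on_rationals (R : realType) (f : R -> R) (b : R) :
  {within `[0, b], continuous f} ->
  (forall q : rat, 0 <= (ratr q : R) <= b -> f (ratr q) = 0) ->
  forall t, 0 <= t < b -> f t = 0.
Proof.
move=> cf f0 t /andP[t0 tb]; apply/eqP; apply: contrapT => /negP ft.
have tD : `[0, b]%classic t by rewrite /= in_itv/= t0 ltW.
have nf : 0 < `|f t| by rewrite normr_gt0.
have := (subspace_continuousP _ _).1 cf _ tD.
move=> /cvgrPdist_lt/(_ _ nf)/nbhs_ballP[e /= e0 H].
have [|q] := @rat_in_itvoo R t (Num.min (t + e) b).
  by rewrite lt_min ltrDl e0.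
rewrite in_itv/= lt_min => /and3P[tq qe qb].
have qD : 0 <= (ratr q : R) <= b by rewrite (le_trans t0 (ltW tq)) ltW.
have := H (ratr q).
rewrite /ball/= ltr0_norm ?subr_lt0// opprB ltrBlDl => /(_ qe).
by rewrite in_itv/= qD => /(_ isT); rewrite /from_subspace f0// subr0 ltxx.
Qed.

Lemma continuous_paths_eq (R : realType) (X I : R -> R) (T : R) :
  {within `[0, +oo[, continuous X} -> {within `[0, +oo[, continuous I} ->
  (forall q : rat, 0 <= (ratr q : R) ->
    (\int[lebesgue_measure]_(u in `[0%R, (ratr q : R)]) X u)%R =
    I (ratr q) - (T - ratr q) * X (ratr q)) ->
  forall t, 0 <= t ->
    (\int[lebesgue_measure]_(u in `[0, t]) X u)%R = I t - (T - t) * X t.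
Proof.
move=> cX cI H t t0.
pose f u := (\int[lebesgue_measure]_(v in `[0%R, u]) X v)%R - (I u - (T - u) * X u).
have sub : `[0, t + 1] `<=` `[0, +oo[%classic.
  by move=> u /=; rewrite !in_itv/= andbT => /andP[].
have cXb : {within `[0, t + 1], continuous X} := continuous_subspaceW sub cX.
have cIb : {within `[0, t + 1], continuous I} := continuous_subspaceW sub cI.
have tt1 : 0 <= t + 1 by rewrite addr_ge0.
have iX : lebesgue_measure.-integrable `[0, t + 1] (EFin \o X).
  by apply: continuous_compact_integrable; [exact: segment_compact|exact: cXb].
have cf : {within `[0, t + 1], continuous f}.
  move=> u; apply: cvgB; first exact: (parameterized_integral_continuous tt1 iX).
  apply: cvgB; first exact: cIb.
  apply: cvgM; last exact: cXb.
  by apply: cvgB; [exact: cvg_cst|exact: (continuous_subspaceT (fun x => cvg_id))].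
apply/eqP; rewrite -subr_eq0; apply/eqP.
apply: (@eq_on_rationals _ f (t + 1) cf); last by rewrite t0 ltrDl ltr01.
by move=> q /andP[q0 _]; rewrite /f H// subrr.
Qed.

(** The identity holds almost surely at each fixed time, hence almost surely at
    all rational times at once, and then at all times because both sides have
    continuous paths. *)
Theorem proposition2p1 (d : measure_display) (Omega : measurableType d)
  (R : realType) (P : probability Omega R) (F : R -> set (set Omega))
  (X : R -> Omega -> R) (QX : Omega -> cumulative R R)
  (hF : is_filtration F)
  (hX : continuous_local_martingale P F X)
  (hX0 : {ae P, forall w, X 0 w = 0})
  (hQX : quadratic_variation P F X QX) :
  (forall T r sigma : R, 0 < T -> 0 < r -> 0 < sigma ^+ 2 ->
    (P [set w | (r <= \int[lebesgue_measure]_(u in `[0, T]) X u w)%R /\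
                \int[lebesgue_stieltjes_measure (QX w)]_(u in `[0%R, T])
                  ((T - u) ^+ 2)%:E <= (sigma ^+ 2)%:E]
     <= (expR (- (r ^+ 2 / (2 * sigma ^+ 2))))%:E)%E) /\
  (forall (T : R) (I : R -> Omega -> R), 0 < T ->
    stochastic_integral P F X QX (fun u _ => T - u) I ->
    {ae P, forall w, forall t, 0 <= t <= T ->
      \int[lebesgue_measure]_(u in `[0, t]) X u w
        = I t w - (T - t) * X t w}).
Proof.
split=> [T r sigma T0 r0 s0|T I T0 hI].
  exact: integral_tail_bound hX hX0 hQX T0 r0 s0.
have [aX cX _] := hX; have [Q0 cQ [aQ _]] := hQX; have [_ cI _ _] := hI.
have approx : simple_approximation P F QX (fun u _ => T - u)
    (left_point_process Omega T).
  split=> [n|t t0]; first exact: left_point_predictable.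
  exact: left_point_approximation_at Q0 cQ aQ _ t t0.
have : {ae P, forall w, forall n : nat,
    forall q : rat, pickle q = n -> 0 <= (ratr q : R) ->
    (\int[lebesgue_measure]_(u in `[0%R, (ratr q : R)]) X u w)%R =
    I (ratr q) w - (T - ratr q) * X (ratr q) w}.
  apply: ae_foralln => n.
  case E : (unpickle n : option rat) => [q|]; last first.
    by apply: aeW => w q qn; rewrite -qn pickleK in E.
  have [q0|q0] := leP 0 (ratr q : R); last first.
    by apply: aeW => w q' qn; rewrite -qn pickleK in E; case: E => ->; rewrite leNgt q0.
  apply: filterS (stochastic_integral_at hF aX cX q0 hI hX0 approx) => w h q' qn _.
  by rewrite -qn pickleK in E; case: E => ->.
apply: filterS => w h t /andP[t0 _].
apply: (@continuous_paths_eq _ (X ^~ w) (I ^~ w) T (@cX w) (@cI w) _ _ t0).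
by move=> q q0; exact: h.
Qed.
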